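(* $\mathsf C_{\mathbb N^\mathbb N}<_W\overline{\mathsf C_{\mathbb N^\mathbb N}}<_W\mathsf T\mathsf C_{\mathbb N^\mathbb N}<_W\mathsf C_{\mathbb N^\mathbb N}*\overline{\mathsf C_{\mathbb N^\mathbb N}}\equiv_W\mathsf C_{\mathbb N^\mathbb N}*\mathsf T\mathsf C_{\mathbb N^\mathbb N}$.
   Context: A problem $f:\subseteq X\rightrightarrows Y$ between represented spaces is a partial multi-valued map; $F\vdash f$ means $\delta_YF(p)\in f(\delta_X(p))$ whenever $\delta_X(p)\in\mathrm{dom}(f)$; $f\le_W g$ iff there are computable partial $H,K$ with $H\langle\mathrm{id},GK\rangle\vdash f$ for all $G\vdash g$; $\equiv_W$ and $<_W$ are the induced equivalence and strict order. The compositional product $f*g$ is a problem representing the $\le_W$-maximum of $\{f_0\circ g_0:f_0\le_Wf,\ g_0\le_Wg\}$ (which exists). $\mathcal A_-(\mathbb N^\mathbb N)$ is the space of closed subsets of Baire space represented by $p\mapsto\mathbb N^\mathbb N\setminus\bigcup_nB_{p(n)}$ for a standard enumeration $(B_n)$ of basic open sets (including empty ones). $\mathsf C_{\mathbb N^\mathbb N}:\subseteq\mathcal A_-(\mathbb N^\mathbb N)\rightrightarrows\mathbb N^\mathbb N$, $A\mapsto A$, on nonempty $A$. For $p\in\mathbb{N}^\mathbb{N}$, $p-1$ is the concatenation of $p(0)-1,p(1)-1,\dots$ with $0-1$ the empty word; the completion of $(X,\delta_X)$ is $\overline X=X\cup\{\bot\}$ with $\delta_{\overline X}(p)=\delta_X(p-1)$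 if $p-1$ is an infinite sequence in $\mathrm{dom}(\delta_X)$, $\bot$ otherwise. For $f:\subseteq X\rightrightarrows Y$: $\overline f:\overline X\rightrightarrows\overline Y$ equals $f$ on $\mathrm{dom}(f)$ and $\overline Y$ elsewhere; $\mathsf Tf:X\rightrightarrows Y$ equals $f$ on $\mathrm{dom}(f)$ and $Y$ elsewhere. *)

(* Defs.v *)
From Stdlib Require Import Arith List.
Import ListNotations.

Definition Baire := nat -> nat.

Inductive term : Type :=
| TZero : term
| TSucc : term
| TProj : nat -> term
| TOracle : term
| TComp : term -> list term -> term
| TPrim : term -> term -> term
| TMu : term -> term.

Inductive eval (p : Baire) : term -> list nat -> nat -> Prop :=
| ev_zero : forall args, eval p TZero args 0
| ev_succ : forall x args, eval p TSucc (x :: args) (S x)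
| ev_proj : forall i args, i < length args -> eval p (TProj i) args (nth i args 0)
| ev_oracle : forall x args, eval p TOracle (x :: args) (p x)
| ev_comp : forall f gs args vs v,
    evals p gs args vs -> eval p f vs v -> eval p (TComp f gs) args v
| ev_prim0 : forall b s rest v, eval p b rest v -> eval p (TPrim b s) (0 :: rest) v
| ev_primS : forall b s n rest w v,
    eval p (TPrim b s) (n :: rest) w -> eval p s (n :: w :: rest) v ->
    eval p (TPrim b s) (S n :: rest) v
| ev_mu : forall f args n,
    eval p f (n :: args) 0 ->
    (forall m, m < n -> exists k, eval p f (m :: args) (S k)) ->
    eval p (TMu f) args n
with evals (p : Baire) : list term -> list nat -> list nat -> Prop :=
| evs_nil : forall args, evals p [] args []
| evs_cons : forall g gs args v vs,
    eval p g args v -> evals p gs args vs -> evals p (g :: gs) args (v :: vs).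

Definition pfun := Baire -> option Baire.

Definition computable (H : pfun) : Prop :=
  exists t : term, forall p q, H p = Some q -> forall n, eval p t [n] (q n).

Definition bpair (p q : Baire) : Baire :=
  fun n => if Nat.even n then p (Nat.div2 n) else q (Nat.div2 n).

Record RepSp : Type := { carrier : Type; delta : Baire -> carrier -> Prop }.

Definition problem (X Y : RepSp) : Type := carrier X -> carrier Y -> Prop.

Definition dom {X Y : RepSp} (f : problem X Y) (x : carrier X) : Prop :=
  exists y, f x y.

Definition realizes {X Y : RepSp} (F : pfun) (f : problem X Y) : Prop :=
  forall p x, delta X p x -> dom f x ->
    exists q, F p = Some q /\ exists y, delta Y q y /\ f x y.

Definition obind (o : option Baire) (k : Baire -> option Baire) : option Baire :=
  match o with Some a => k a | None => None end.

Definition Wred {X Y X' Y' : RepSp} (f : problem X Y) (g : problem X' Y') : Prop :=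
  exists H K : pfun, computable H /\ computable K /\
    forall G : pfun, realizes G g ->
      realizes (fun p => obind (K p) (fun k => obind (G k) (fun r => H (bpair p r)))) f.

Definition Wequiv {X Y X' Y' : RepSp} (f : problem X Y) (g : problem X' Y') : Prop :=
  Wred f g /\ Wred g f.

Definition Wlt {X Y X' Y' : RepSp} (f : problem X Y) (g : problem X' Y') : Prop :=
  Wred f g /\ ~ Wred g f.

Definition pcomp {X Y Z : RepSp} (f : problem Y Z) (g : problem X Y) : problem X Z :=
  fun x z => (forall y, g x y -> dom f y) /\ exists y, g x y /\ f y z.

(** h represents the compositional product f * g, i.e. the <=_W-maximum of
    { f0 o g0 : f0 <=_W f, g0 <=_W g }. *)
Definition IsCompProd {A B C D : RepSp} (f : problem A B) (g : problem C D)
    {U V : RepSp} (h : problem U V) : Prop :=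
  (forall (X Y Z : RepSp) (f0 : problem Y Z) (g0 : problem X Y),
      Wred f0 f -> Wred g0 g -> Wred (pcomp f0 g0) h) /\
  (exists (X Y Z : RepSp) (f0 : problem Y Z) (g0 : problem X Y),
      Wred f0 f /\ Wred g0 g /\ Wred h (pcomp f0 g0)).

Definition BaireSp : RepSp := {| carrier := Baire; delta := fun p x => forall n, x n = p n |}.

(** Standard enumeration of words via Cantor unpairing *)
Definition unpair (z : nat) : nat * nat :=
  let w := (Nat.sqrt (8 * z + 1) - 1) / 2 in
  let t := w * (w + 1) / 2 in
  let y := z - t in (w - y, y).

Fixpoint dec_aux (fuel n : nat) : list nat :=
  match fuel with
  | 0 => []
  | S f => match n with
           | 0 => []
           | S m => fst (unpair m) :: dec_aux f (snd (unpair m))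
           end
  end.

Definition word (n : nat) : list nat := dec_aux n n.

Definition inB (n : nat) (x : Baire) : Prop :=
  match n with
  | 0 => False
  | S m => forall i, i < length (word m) -> x i = nth i (word m) 0
  end.

Definition ClosedSp : RepSp :=
  {| carrier := Baire -> Prop;
     delta := fun p A => forall x, A x <-> ~ (exists n, inB (p n) x) |}.

Definition CB : problem ClosedSp BaireSp := fun A x => A x.

Fixpoint cnt (p : Baire) (i : nat) : nat :=
  match i with
  | 0 => 0
  | S j => cnt p j + (if Nat.eqb (p j) 0 then 0 else 1)
  end.

(** [minus1 p q]: p-1 is an infinite sequence and equals q *)
Definition minus1 (p q : Baire) : Prop :=
  forall k, exists i, p i <> 0 /\ cnt p i = k /\ q k = p i - 1.

Definition completion (X : RepSp) : RepSp :=
  {| carrier := option (carrier X);   (* None = bottom *)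
     delta := fun p ox => match ox with
                          | Some x => exists q, minus1 p q /\ delta X q x
                          | None => ~ (exists q x, minus1 p q /\ delta X q x)
                          end |}.

Definition pbar {X Y : RepSp} (f : problem X Y) : problem (completion X) (completion Y) :=
  fun ox oy => match ox with
               | Some x => dom f x -> exists y, oy = Some y /\ f x y
               | None => True
               end.

Definition Tot {X Y : RepSp} (f : problem X Y) : problem X Y :=
  fun x y => dom f x -> f x y.

(* Main.v *)
(** Computations are continuous in their oracle, and conversely a term can be run, as a total
    computation, on longer and longer finite prefixes of part of its oracle. Hence any
    co-semidecidable relation [R p x] yields a computable map from [p] to a name of the closed
    set [{x | R p x}]. With it, [Tot CB] factors through [pbar CB] followed by [CB]: from an
    output [r] of [pbar CB], a second choice picks any sequence that continues [r - 1]; the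
    same second choice absorbs whatever is done next with [CB], which gives the equivalence
    of the two compositional products.

    The separations rest on one diagonalization: by a recursion theorem for names of closed
    sets, "[p] names the empty set" is not, even locally in [p], of the form
    "some [x] satisfies [R p x]" with [R] closed. A reduction of [pbar CB] to [CB] would
    provide such a form. So would one of [Tot CB] to [pbar CB], because there the reduction
    can only query nonempty closed sets: otherwise the name [0, 0, ...] of bottom would be an
    admissible answer, and the first letter of the output would be fixed while the input can
    still be changed to forbid it. Finally, [CB] after [Tot CB] decides nonemptiness; if
    [Tot CB] did as well, then near any name on which some answer leads to the verdict
    "nonempty", an empty input would have to be mapped to a nonempty query, again giving
    such a form. *)

From Stdlib Require Import Arith List Lia FunctionalExtensionality Classical ClassicalEpsilon.
Require Import Defs.
Import ListNotations.

(** * Evaluation *)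

(** The generated principle gives no hypothesis for the list nested in [TComp]; here it comes as a
    [Forall]. *)
Lemma term_nested_ind (P : term -> Prop) :
  P TZero -> P TSucc -> (forall i, P (TProj i)) -> P TOracle ->
  (forall f gs, P f -> Forall P gs -> P (TComp f gs)) ->
  (forall b s, P b -> P s -> P (TPrim b s)) -> (forall f, P f -> P (TMu f)) ->
  forall t, P t.
Proof.
  intros h1 h2 h3 h4 h5 h6 h7.
  fix F 1. intros [| | i | | f gs | b s | f].
  - exact h1.
  - exact h2.
  - exact (h3 i).
  - exact h4.
  - apply h5; [apply F|].
    induction gs as [|g gs IH]; constructor; [apply F | exact IH].
  - apply h6; apply F.
  - apply h7, F.
Qed.

(** Recursion on derivations that also reaches the premises hidden in [evals] and below the
    existential of [ev_mu]. *)
Lemma eval_nested_ind (p : Baire) (P : term -> list nat -> nat -> Prop) :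
  (forall args, P TZero args 0) ->
  (forall x args, P TSucc (x :: args) (S x)) ->
  (forall i args, i < length args -> P (TProj i) args (nth i args 0)) ->
  (forall x args, P TOracle (x :: args) (p x)) ->
  (forall f gs args vs v, Forall2 (fun g w => P g args w) gs vs -> P f vs v ->
     P (TComp f gs) args v) ->
  (forall b s rest v, P b rest v -> P (TPrim b s) (0 :: rest) v) ->
  (forall b s n rest w v, P (TPrim b s) (n :: rest) w -> P s (n :: w :: rest) v ->
     P (TPrim b s) (S n :: rest) v) ->
  (forall f args n, P f (n :: args) 0 ->
     (forall m, m < n -> exists k, P f (m :: args) (S k)) -> P (TMu f) args n) ->
  forall t args v, eval p t args v -> P t args v.
Proof.
  intros h1 h2 h3 h4 h5 h6 h7 h8.
  fix F 4 with (G gs args vs (e : evals p gs args vs) {struct e} :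
    Forall2 (fun g w => P g args w) gs vs).
  - intros t args v [].
    + apply h1.
    + apply h2.
    + apply h3; assumption.
    + apply h4.
    + eapply h5; [apply G; eassumption | apply F; assumption].
    + apply h6; apply F; assumption.
    + eapply h7; apply F; eassumption.
    + apply h8; [apply F; assumption|].
      intros m hm. destruct (H0 m hm) as [k hk]. exists k. apply F; exact hk.
  - intros gs args vs []; constructor; [apply F; assumption | apply G; assumption].
Qed.

Lemma evals_Forall2 p gs args vs :
  evals p gs args vs <-> Forall2 (fun g w => eval p g args w) gs vs.
Proof.
  split; induction 1; constructor; auto.
Qed.

Lemma eval_det p t args v : eval p t args v -> forall v', eval p t args v' -> v = v'.
Proof.
  revert t args v.
  apply (eval_nested_ind p (fun t args v => forall v', eval p t args v' -> v = v')).
  - intros args v' h; inversion h; reflexivity.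
  - intros x args v' h; inversion h; reflexivity.
  - intros i args hi v' h; inversion h; reflexivity.
  - intros x args v' h; inversion h; reflexivity.
  - intros f gs args vs v hgs hf v' h. inversion h as [| | | |? ? ? vs' ? h1 h2| | |]; subst.
    apply hf. replace vs with vs'; [assumption|].
    clear - hgs h1. apply evals_Forall2 in h1. revert vs' h1.
    induction hgs as [|g w gs vs hg _ IH]; intros vs' h1; inversion h1; subst.
    + reflexivity.
    + f_equal; [symmetry; auto | auto].
  - intros b s rest v h v' h'. inversion h'; subst. auto.
  - intros b s n rest w v h1 h2 v' h'. inversion h'; subst.
    apply h2. replace w with w0; [assumption|]. symmetry; auto.
  - intros f args n h1 h2 v' h'. inversion h' as [| | | | | | |? ? ? h3 h4]; subst.
    destruct (lt_eq_lt_dec n v') as [[hl|he]|hg]; auto.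
    + destruct (h4 n hl) as [k hk]. specialize (h1 _ hk). discriminate.
    + destruct (h2 v' hg) as [k hk]. specialize (hk _ h3). discriminate.
Qed.

Definition agree (j : nat) (p q : Baire) : Prop := forall i, i < j -> p i = q i.

Lemma agree_le j k p q : j <= k -> agree k p q -> agree j p q.
Proof. intros h1 h2 i hi. apply h2. lia. Qed.

Lemma agree_sym j p q : agree j p q -> agree j q p.
Proof. intros h i hi. symmetry. auto. Qed.

Lemma agree_trans j p q r : agree j p q -> agree j q r -> agree j p r.
Proof. intros h h' i hi. rewrite h; auto. Qed.

Lemma bounded_max (Q : nat -> nat -> Prop) :
  (forall i j k, j <= k -> Q i j -> Q i k) ->
  forall n, (forall i, i < n -> exists j, Q i j) -> exists j, forall i, i < n -> Q i j.
Proof.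
  intros mono n. induction n as [|n IH]; intros h.
  - exists 0; intros; lia.
  - destruct IH as [j hj]; [intros; apply h; lia|].
    destruct (h n) as [j' hj']; [lia|].
    exists (max j j'). intros i hi.
    destruct (Nat.eq_dec i n) as [->|].
    + eapply mono; [|exact hj']; lia.
    + eapply mono; [|apply hj]; lia.
Qed.

(** A derivation is finite and so consults the oracle finitely often. For [TMu], the uses of the
    finitely many failed candidates are merged by [bounded_max]. *)
Lemma eval_use p t args v :
  eval p t args v -> exists j, forall q, agree j p q -> eval q t args v.
Proof.
  revert t args v.
  apply (eval_nested_ind p
    (fun t args v => exists j, forall q, agree j p q -> eval q t args v)).
  - intros; exists 0; constructor.
  - intros; exists 0; constructor.
  - intros; exists 0; constructor; assumption.
  - intros x args; exists (S x); intros q h. rewrite h by lia. constructor.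
  - intros f gs args vs v hgs [j hj].
    assert (exists j, forall q, agree j p q -> evals q gs args vs) as [k hk].
    { clear - hgs. induction hgs as [|g w gs vs [j hj] _ [k hk]].
      - exists 0; constructor.
      - exists (max j k). intros q h. constructor.
        + apply hj. eapply agree_le; [|exact h]; lia.
        + apply hk. eapply agree_le; [|exact h]; lia. }
    exists (max j k). intros q h. econstructor.
    + apply hk. eapply agree_le; [|exact h]; lia.
    + apply hj. eapply agree_le; [|exact h]; lia.
  - intros b s rest v [j hj]. exists j. intros. constructor; auto.
  - intros b s n rest w v [j hj] [k hk]. exists (max j k). intros q h. econstructor.
    + apply hj. eapply agree_le; [|exact h]; lia.
    + apply hk. eapply agree_le; [|exact h]; lia.
  - intros f args n [j hj] h.
    destruct (bounded_max
      (fun m j => exists k, forall q, agree j p q -> eval q f (m :: args) (S k)))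
      with (n := n) as [l hl].
    + intros m i k hik [v hv]. exists v. intros q hq. apply hv. eapply agree_le; eauto.
    + intros m hm. destruct (h m hm) as [k [i hi]]. eauto.
    + exists (max j l). intros q hq. constructor.
      * apply hj. eapply agree_le; [|exact hq]; lia.
      * intros m hm. destruct (hl m hm) as [k hk]. exists k. apply hk.
        eapply agree_le; [|exact hq]; lia.
Qed.

(** This realizes composition of functionals: every oracle query is replaced by a run of [s]. *)
Fixpoint subst_oracle (s t : term) : term :=
  match t with
  | TOracle => TComp s [TProj 0]
  | TComp f gs => TComp (subst_oracle s f) (map (subst_oracle s) gs)
  | TPrim b r => TPrim (subst_oracle s b) (subst_oracle s r)
  | TMu f => TMu (subst_oracle s f)
  | t => t
  end.

Lemma eval_subst_oracle p q s t args v :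
  (forall n, eval p s [n] (q n)) -> eval q t args v -> eval p (subst_oracle s t) args v.
Proof.
  intros hs. revert t args v.
  apply (eval_nested_ind q (fun t args v => eval p (subst_oracle s t) args v));
    try (intros; simpl; constructor; auto; fail).
  - intros x args. simpl. econstructor; [|apply hs].
    constructor; [|constructor]. apply (ev_proj p 0 (x :: args)). simpl; lia.
  - intros f gs args vs v hgs hf. simpl. econstructor; [|exact hf].
    apply evals_Forall2. clear - hgs. induction hgs; constructor; auto.
  - intros b r n rest w v h1 h2. simpl in *. econstructor; eauto.
Qed.

(** * Total computable functionals of fixed arity *)

(** The list acts as an environment of [a] de Bruijn variables, so computability can be read off the
    shape of an expression without ever writing its term. *)
Definition tot (a : nat) (f : Baire -> list nat -> nat) : Prop :=
  exists t, forall p e, length e = a -> eval p t e (f p e).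

Lemma tot_ext a f g : tot a f -> (forall p e, length e = a -> f p e = g p e) -> tot a g.
Proof. intros [t ht] h. exists t. intros p e he. rewrite <- h by auto. auto. Qed.

Lemma tot_proj a i : i < a -> tot a (fun p e => nth i e 0).
Proof. intros h. exists (TProj i). intros p e <-. constructor; auto. Qed.

Lemma tot_comp a b f gs :
  tot b f -> length gs = b -> Forall (tot a) gs ->
  tot a (fun p e => f p (map (fun g => g p e) gs)).
Proof.
  intros [t ht] hl hgs.
  assert (exists ts, Forall2 (fun g s => forall p e, length e = a -> eval p s e (g p e)) gs ts)
    as [ts hts].
  { clear - hgs. induction hgs as [|g gs [s hs] _ [ts hts]]; eauto. }
  exists (TComp t ts). intros p e he. econstructor.
  - apply evals_Forall2. instantiate (1 := map (fun g => g p e) gs).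
    clear - hts he. induction hts; simpl; constructor; auto.
  - apply ht. rewrite length_map; auto.
Qed.

Lemma tot_S a g : tot a g -> tot a (fun p e => S (g p e)).
Proof.
  intros [t ht]. exists (TComp TSucc [t]). intros p e he.
  econstructor; [|constructor]. repeat constructor; auto.
Qed.

Lemma tot_const a c : tot a (fun p e => c).
Proof.
  induction c as [|c IH]; [|apply tot_S, IH].
  exists TZero. intros; constructor.
Qed.

Lemma tot_oracle a g : tot a g -> tot a (fun p e => p (g p e)).
Proof.
  intros [t ht]. exists (TComp TOracle [t]). intros p e he.
  econstructor; [|constructor]. repeat constructor; auto.
Qed.

Lemma evals_proj_seq p e k r :
  k + r = length e -> evals p (map TProj (seq k r)) e (skipn k e).
Proof.
  revert k. induction r as [|r IH]; intros k h.
  - rewrite skipn_all2 by lia. constructor.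
  - assert (skipn k e = nth k e 0 :: skipn (S k) e) as ->.
    { clear IH. revert e h. induction k as [|k IHk]; intros [|x e] h; simpl in *; try lia; auto. }
    simpl map. constructor; [constructor; lia | apply IH; lia].
Qed.

Lemma tot_rec a b s n :
  tot a b -> tot (S (S a)) s -> tot a n ->
  tot a (fun p e => nat_rect (fun _ => nat) (b p e) (fun i w => s p (i :: w :: e)) (n p e)).
Proof.
  intros [tb hb] [ts hs] [tn hn].
  exists (TComp (TPrim tb ts) (tn :: map TProj (seq 0 a))). intros p e he.
  econstructor.
  - constructor; [apply hn; auto|]. apply evals_proj_seq; auto.
  - simpl. induction (n p e) as [|k IH]; simpl.
    + constructor; auto.
    + econstructor; [exact IH|]. apply hs. simpl; auto.
Qed.

(** Bodies of recursions and searches see extra variables in front of the environment; this drops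
    [k] of them and keeps one computed head. *)
Lemma tot_select a f k r :
  tot (S r) f -> k + r = a -> forall g, tot a g ->
  tot a (fun p e => f p (g p e :: skipn k e)).
Proof.
  intros [t ht] h g [s hs]. exists (TComp t (s :: map TProj (seq k r))).
  intros p e he. econstructor.
  - constructor; [apply hs; auto | apply evals_proj_seq; lia].
  - apply ht. simpl. rewrite length_skipn. lia.
Qed.

Lemma tot_drop a f k r :
  tot r f -> k + r = a -> tot a (fun p e => f p (skipn k e)).
Proof.
  intros [t ht] h. exists (TComp t (map TProj (seq k r))).
  intros p e he. econstructor.
  - apply evals_proj_seq; lia.
  - apply ht. rewrite length_skipn. lia.
Qed.

Lemma tot_mu a f g :
  tot (S a) f ->
  (forall p e, length e = a ->
     f p (g p e :: e) = 0 /\ forall m, m < g p e -> f p (m :: e) <> 0) ->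
  tot a g.
Proof.
  intros [t ht] h. exists (TMu t). intros p e he. destruct (h p e he) as [h1 h2].
  constructor.
  - rewrite <- h1. apply ht. simpl; auto.
  - intros m hm. specialize (h2 m hm). exists (pred (f p (m :: e))).
    replace (S (pred (f p (m :: e)))) with (f p (m :: e)) by lia. apply ht; simpl; auto.
Qed.

Lemma tot_case a c x y :
  tot a c -> tot a x -> tot (S a) y ->
  tot a (fun p e => match c p e with 0 => x p e | S k => y p (k :: e) end).
Proof.
  intros hc hx hy.
  eapply tot_ext with (f := fun p e =>
    nat_rect (fun _ => nat) (x p e) (fun i w => y p (i :: e)) (c p e)).
  - apply (tot_rec a x (fun p e => y p (nth 0 e 0 :: skipn 2 e)) c); auto.
    apply (tot_select (S (S a)) y 2 a hy); [lia|]. apply tot_proj; lia.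
  - intros p e he; simpl. destruct (c p e); reflexivity.
Qed.

Lemma tot_ifz a c x y :
  tot a c -> tot a x -> tot a y ->
  tot a (fun p e => match c p e with 0 => x p e | S _ => y p e end).
Proof.
  intros hc hx hy. apply (tot_case a c x (fun p e => y p (skipn 1 e))); auto.
  apply (tot_drop (S a) y 1 a); auto.
Qed.

Lemma tot_pred a g : tot a g -> tot a (fun p e => pred (g p e)).
Proof.
  intros h. eapply tot_ext.
  - apply (tot_case a g (fun _ _ => 0) (fun p e => nth 0 e 0)); auto.
    + apply tot_const.
    + apply tot_proj; lia.
  - intros p e _; simpl. destruct (g p e); reflexivity.
Qed.

Lemma tot_add a g h : tot a g -> tot a h -> tot a (fun p e => g p e + h p e).
Proof.
  intros hg hh. eapply tot_ext.
  - apply (tot_rec a g (fun p e => S (nth 1 e 0)) h); auto.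
    apply tot_S, tot_proj; lia.
  - intros p e he; simpl. induction (h p e); simpl; lia.
Qed.

Lemma tot_sub a g h : tot a g -> tot a h -> tot a (fun p e => g p e - h p e).
Proof.
  intros hg hh. eapply tot_ext.
  - apply (tot_rec a g (fun p e => pred (nth 1 e 0)) h); auto.
    apply tot_pred, tot_proj; lia.
  - intros p e he; simpl. induction (h p e); simpl; lia.
Qed.

Lemma tot_mul a g h : tot a g -> tot a h -> tot a (fun p e => g p e * h p e).
Proof.
  intros hg hh. eapply tot_ext.
  - apply (tot_rec a (fun _ _ => 0) (fun p e => nth 1 e 0 + g p (skipn 2 e)) h); auto.
    + apply tot_const.
    + apply tot_add; [apply tot_proj; lia | eapply tot_drop; eauto].
  - intros p e he; simpl. induction (h p e); simpl in *; lia.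
Qed.

Create HintDb tot.
#[export] Hint Resolve tot_const tot_S tot_pred tot_add tot_sub tot_mul tot_oracle tot_ifz : tot.
#[export] Hint Extern 1 (tot _ (fun p e => nth ?i e 0)) => apply tot_proj; lia : tot.

Lemma tot_div2 a g : tot a g -> tot a (fun p e => Nat.div2 (g p e)).
Proof.
  (* The half of [g] is the least [n] with [g < 2 * (n + 1)]; truncated subtraction turns this into
     a search for a zero. *)
  intros h. apply (tot_mu a (fun p e => S (g p (skipn 1 e)) - 2 * S (nth 0 e 0))).
  - assert (tot (S a) (fun p e => g p (skipn 1 e))) by (eapply tot_drop; eauto).
    apply tot_sub; auto with tot.
  - intros p e he. cbn [skipn nth]. rewrite Nat.div2_div.
    pose proof (Nat.div_mod_eq (g p e) 2). pose proof (Nat.mod_upper_bound (g p e) 2).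
    split; [lia|]. intros m hm. lia.
Qed.

Lemma tot_sqrt a g : tot a g -> tot a (fun p e => Nat.sqrt (g p e)).
Proof.
  intros h. apply (tot_mu a (fun p e => S (g p (skipn 1 e)) - S (nth 0 e 0) * S (nth 0 e 0))).
  - assert (tot (S a) (fun p e => g p (skipn 1 e))) by (eapply tot_drop; eauto).
    apply tot_sub; auto with tot.
  - intros p e he. cbn [skipn nth].
    pose proof (Nat.sqrt_spec (g p e) (Nat.le_0_l _)).
    split; [lia|]. intros m hm.
    assert (S m * S m <= Nat.sqrt (g p e) * Nat.sqrt (g p e)) by (apply Nat.mul_le_mono; lia).
    lia.
Qed.
#[export] Hint Resolve tot_div2 tot_sqrt : tot.

(** * Codes of words *)

Lemma unpair_surj a b : exists z, unpair z = (a, b).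
Proof.
  set (w := a + b). exists (w * (w + 1) / 2 + b). set (t := w * (w + 1) / 2).
  assert (ht : 2 * t = w * (w + 1)).
  { unfold t. pose proof (Nat.div_mod_eq (w * (w + 1)) 2) as h.
    assert ((w * (w + 1)) mod 2 = 0) as h0; [|lia].
    apply Nat.Div0.mod_divides. destruct (Nat.Even_or_Odd w) as [[k hk]|[k hk]].
    - exists (k * (w + 1)). nia.
    - exists (w * (k + 1)). nia. }
  assert (hs : (Nat.sqrt (8 * (t + b) + 1) - 1) / 2 = w).
  { pose proof (Nat.sqrt_spec (8 * (t + b) + 1) (Nat.le_0_l _)) as [h1 h2].
    set (s := Nat.sqrt (8 * (t + b) + 1)) in *.
    (* Since [8 * t + 1] equals [(2 * w + 1) ^ 2] and [b <= w], the root lies below [2 * w + 3], so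
       halving [s - 1] recovers [w]. *)
    assert (2 * w + 1 <= s) by nia. assert (s <= 2 * w + 2) by nia.
    symmetry. apply (Nat.div_unique _ 2 w (s - 1 - 2 * w)); lia. }
  unfold unpair. rewrite hs. fold t. f_equal; lia.
Qed.

Lemma unpair_snd_le z : snd (unpair z) <= z.
Proof. unfold unpair. simpl snd. lia. Qed.

Definition code_tail (n : nat) : nat := match n with 0 => 0 | S m => snd (unpair m) end.

#[local] Opaque unpair.

(* [lookup n i] is [S v] if [v] is the [i]-th letter of [word n], and [0] past its end. *)
Definition lookup (n i : nat) : nat :=
  match Nat.iter i code_tail n with 0 => 0 | S m => S (fst (unpair m)) end.

(** The code of the rest is smaller than the whole code, so any fuel at least as large as the code
    gives the same word. *)
Lemma word_S m : word (S m) = fst (unpair m) :: word (snd (unpair m)).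
Proof.
  pose proof unpair_snd_le as hle.
  assert (fuel : forall f f' n, n <= f -> n <= f' -> dec_aux f n = dec_aux f' n).
  { induction f as [|f IH]; intros [|f'] [|n] h h'; simpl; try lia; auto.
    specialize (hle n). f_equal. apply IH; lia. }
  change (fst (unpair m) :: dec_aux m (snd (unpair m)) =
    fst (unpair m) :: word (snd (unpair m))).
  f_equal. apply fuel; [apply hle | apply le_n].
Qed.

Lemma lookup_word n i :
  lookup n i = match nth_error (word n) i with Some v => S v | None => 0 end.
Proof.
  unfold lookup. revert n. induction i as [|i IH]; intros n.
  - destruct n; [reflexivity | rewrite word_S; reflexivity].
  - rewrite Nat.iter_succ_r, IH. destruct n; cbn [code_tail].
    + destruct i; reflexivity.
    + rewrite word_S. reflexivity.
Qed.

Lemma length_word_le n : length (word n) <= n.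
Proof.
  unfold word. generalize n at 1 3. intro f. revert n.
  induction f as [|f IH]; intros [|n]; simpl; try lia.
  specialize (IH (snd (unpair n))). lia.
Qed.

Lemma word_surj l : exists n, word n = l.
Proof.
  induction l as [|a l [n hn]].
  - exists 0; reflexivity.
  - destruct (unpair_surj a n) as [z hz]. exists (S z). rewrite word_S, hz. simpl; congruence.
Qed.

#[local] Opaque word.

Lemma inB_lookup m x : inB (S m) x <-> forall i, lookup m i = 0 \/ lookup m i = S (x i).
Proof.
  simpl. split; intros h i.
  - rewrite lookup_word. destruct (nth_error (word m) i) as [v|] eqn:e; auto.
    right. rewrite h.
    + f_equal. symmetry. apply nth_error_nth; auto.
    + apply nth_error_Some. congruence.
  - intros hi. specialize (h i). rewrite lookup_word in h.
    rewrite (nth_error_nth' _ 0 hi) in h. destruct h; congruence.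
Qed.

(** A word is never longer than its code, so the index of a ball also bounds how many letters the
    ball inspects. *)
Lemma inB_agree n x y : inB n x -> agree n x y -> inB n y.
Proof.
  destruct n as [|m]; simpl; auto. intros h ha i hi. rewrite <- h by auto. symmetry.
  apply ha. pose proof (length_word_le m). lia.
Qed.

Lemma prefix_code x j :
  exists m, length (word m) = j /\ forall y, inB (S m) y <-> agree j x y.
Proof.
  destruct (word_surj (map x (seq 0 j))) as [m hm]. exists m.
  simpl. rewrite hm, length_map, length_seq. split; auto. intros y.
  assert (hn : forall i, i < j -> nth i (map x (seq 0 j)) 0 = x i).
  { intros i hi. rewrite nth_indep with (d' := x 0) by (rewrite length_map, length_seq; auto).
    rewrite map_nth, seq_nth; auto. }
  split; intros h i hi; specialize (h i hi); rewrite hn in * by auto; auto.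
Qed.

#[local] Transparent unpair.

Lemma tot_unpair_fst a g : tot a g -> tot a (fun p e => fst (unpair (g p e))).
Proof.
  intros h. eapply tot_ext with (f := fun p e =>
    let w := Nat.div2 (Nat.sqrt (8 * g p e + 1) - 1) in
    w - (g p e - Nat.div2 (w * (w + 1)))); cbv zeta.
  - auto 12 with tot.
  - intros p e _. unfold unpair. simpl fst. rewrite !Nat.div2_div. reflexivity.
Qed.

Lemma tot_unpair_snd a g : tot a g -> tot a (fun p e => snd (unpair (g p e))).
Proof.
  intros h. eapply tot_ext with (f := fun p e =>
    let w := Nat.div2 (Nat.sqrt (8 * g p e + 1) - 1) in
    g p e - Nat.div2 (w * (w + 1))); cbv zeta.
  - auto 12 with tot.
  - intros p e _. unfold unpair. simpl snd. rewrite !Nat.div2_div. reflexivity.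
Qed.
#[local] Opaque unpair.
#[export] Hint Resolve tot_unpair_fst tot_unpair_snd : tot.

Lemma tot_lookup a g h : tot a g -> tot a h -> tot a (fun p e => lookup (g p e) (h p e)).
Proof.
  intros hg hh. unfold lookup. eapply tot_ext.
  - apply (tot_case a (fun p e => nat_rect (fun _ => nat) (g p e)
      (fun _ w => match w with 0 => 0 | S m => snd (unpair m) end) (h p e))
      (fun _ _ => 0) (fun p e => S (fst (unpair (nth 0 e 0))))); auto with tot.
    apply (tot_rec a g (fun p e => match nth 1 e 0 with 0 => 0 | S m => snd (unpair m) end) h);
      auto.
    apply (tot_case (S (S a)) (fun p e => nth 1 e 0) (fun _ _ => 0)
      (fun p e => snd (unpair (nth 0 e 0)))); auto with tot.
  - intros p e _. unfold Nat.iter. reflexivity.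
Qed.
#[export] Hint Resolve tot_lookup : tot.

Definition eq_test (m n : nat) : nat := (m - n) + (n - m).

Lemma eq_test_0 m n : eq_test m n = 0 <-> m = n.
Proof. unfold eq_test. lia. Qed.

Lemma tot_eq_test a g h : tot a g -> tot a h -> tot a (fun p e => eq_test (g p e) (h p e)).
Proof. intros. unfold eq_test. auto with tot. Qed.
#[export] Hint Resolve tot_eq_test : tot.

Definition sum_below (f : nat -> nat) (n : nat) : nat :=
  nat_rect (fun _ => nat) 0 (fun i w => w + f i) n.

Lemma sum_below_0 f n : sum_below f n = 0 <-> forall i, i < n -> f i = 0.
Proof.
  induction n as [|n IH]; simpl; [split; intros; lia|].
  split.
  - intros h i hi. destruct (Nat.eq_dec i n) as [->|]; [lia|]. apply IH; lia.
  - intros h. rewrite (proj2 IH), (h n) by auto. reflexivity.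
Qed.

Lemma tot_sum_below a f n :
  tot (S a) f -> tot a n -> tot a (fun p e => sum_below (fun i => f p (i :: e)) (n p e)).
Proof.
  intros hf hn. apply (tot_rec a (fun _ _ => 0)
    (fun p e => nth 1 e 0 + f p (nth 0 e 0 :: skipn 2 e)) n); auto with tot.
  apply tot_add; auto with tot.
  apply (tot_select (S (S a)) f 2 a hf); auto with tot.
Qed.

(** Zero means membership, to suit [TMu]. Positions below [m] suffice because [word m] has at most
    [m] letters. *)
Definition inB_test (n : nat) (x : Baire) : nat :=
  match n with
  | 0 => 1
  | S m => sum_below (fun i =>
      match lookup m i with 0 => 0 | S _ => eq_test (lookup m i) (S (x i)) end) m
  end.

Lemma inB_test_0 n x : inB_test n x = 0 <-> inB n x.
Proof.
  destruct n as [|m]; [simpl; lia|]. rewrite inB_lookup. unfold inB_test.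
  rewrite sum_below_0. split; intros h i.
  - destruct (le_lt_dec m i) as [hi|hi].
    + left. rewrite lookup_word. destruct (nth_error (word m) i) eqn:e; auto.
      assert (nth_error (word m) i <> None) as h1 by congruence.
      apply nth_error_Some in h1. pose proof (length_word_le m). lia.
    + specialize (h i hi). destruct (lookup m i); auto. right. apply eq_test_0, h.
  - intros _. specialize (h i). destruct (lookup m i); auto.
    apply eq_test_0. destruct h; congruence.
Qed.

Lemma tot_inB_test a n x :
  tot a n -> tot (S a) x -> tot a (fun p e => inB_test (n p e) (fun i => x p (i :: e))).
Proof.
  intros hn hx. set (body := fun p e =>
    match lookup (nth 1 e 0) (nth 0 e 0) with
    | 0 => 0
    | S _ => eq_test (lookup (nth 1 e 0) (nth 0 e 0)) (S (x p (nth 0 e 0 :: skipn 2 e)))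
    end).
  apply (tot_case a n (fun _ _ => 1)
    (fun p e => sum_below (fun i => body p (i :: e)) (nth 0 e 0))); auto with tot.
  apply (tot_sum_below (S a) body); auto with tot.
  apply tot_ifz; auto with tot. apply tot_eq_test; auto with tot.
  apply tot_S, (tot_select (S (S a)) x 2 a hx); auto with tot.
Qed.

Lemma tot_even a g : tot a g -> tot a (fun p e => if Nat.even (g p e) then 0 else 1).
Proof.
  intros h. eapply tot_ext with (f := fun p e => g p e - 2 * Nat.div2 (g p e));
    auto with tot.
  intros p e _. rewrite Nat.div2_div.
  pose proof (Nat.div_mod_eq (g p e) 2) as h1. destruct (Nat.even (g p e)) eqn:ev.
  - apply Nat.even_spec in ev as [k hk]. rewrite hk, Nat.mul_comm, Nat.div_mul; lia.
  - assert (Nat.odd (g p e) = true) as od by (rewrite <- Nat.negb_even, ev; auto).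
    apply Nat.odd_spec in od as [k hk].
    assert (g p e / 2 = k); [|lia]. symmetry. apply (Nat.div_unique _ 2 k 1); lia.
Qed.

Lemma tot_if_even a c x y :
  tot a c -> tot a x -> tot a y -> tot a (fun p e => if Nat.even (c p e) then x p e else y p e).
Proof.
  intros hc hx hy. eapply tot_ext.
  - apply (tot_ifz a _ x y (tot_even a c hc)); auto.
  - intros p e _; simpl. destruct (Nat.even (c p e)); reflexivity.
Qed.
#[export] Hint Resolve tot_if_even : tot.

(** * Computable names of closed sets *)

Definition evens (p : Baire) : Baire := fun n => p (2 * n).
Definition odds (p : Baire) : Baire := fun n => p (S (2 * n)).

Lemma bpair_even p q n : bpair p q (2 * n) = p n.
Proof.
  unfold bpair. rewrite Nat.even_mul, Nat.div2_double. reflexivity.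
Qed.

Lemma bpair_odd p q n : bpair p q (S (2 * n)) = q n.
Proof.
  unfold bpair. rewrite Nat.even_succ, Nat.odd_mul, Nat.div2_succ_double. reflexivity.
Qed.

Lemma evens_bpair p q : evens (bpair p q) = p.
Proof. extensionality n. apply bpair_even. Qed.

Lemma odds_bpair p q : odds (bpair p q) = q.
Proof. extensionality n. apply bpair_odd. Qed.

Lemma div2_le n : Nat.div2 n <= n.
Proof. rewrite Nat.div2_div. apply Nat.Div0.div_le_upper_bound. lia. Qed.

Lemma agree_bpair j p p' q q' : agree j p p' -> agree j q q' -> agree j (bpair p q) (bpair p' q').
Proof.
  intros h h' i hi. pose proof (div2_le i).
  unfold bpair. destruct (Nat.even i); [apply h | apply h']; lia.
Qed.

(* [c p (m :: args)] approximates [t] on the oracle [bpair p x], given only the finite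
   prefix [word m] of [x]: it is [0] for "no answer yet" and [S v] for the answer [v]. *)
Definition approximates (t : term) (a : nat) (c : Baire -> list nat -> nat) : Prop :=
  tot (S a) c /\
  (forall p m args v x, length args = a -> c p (m :: args) = S v -> inB (S m) x ->
     eval (bpair p x) t args v) /\
  (forall p x args v, length args = a -> eval (bpair p x) t args v ->
     exists N, forall m, N <= length (word m) -> inB (S m) x -> c p (m :: args) = S v).

Lemma approximates_never t a :
  (forall p args v, length args = a -> ~ eval p t args v) -> approximates t a (fun _ _ => 0).
Proof.
  intros h. split; [apply tot_const|]. split.
  - intros; discriminate.
  - intros p x args v hl he. elim (h _ _ _ hl he).
Qed.

Lemma approximates_total t a f :
  tot (S a) f ->
  (forall q m args, length args = a -> forall p, eval q t args (f p (m :: args))) ->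
  approximates t a (fun p e => S (f p e)).
Proof.
  intros hf h. split; [apply tot_S, hf|]. split.
  - intros p m args v x hl e _. injection e as <-. apply h; auto.
  - intros p x args v hl he. exists 0. intros m _ _. f_equal.
    eapply eval_det; [|exact he]. apply h; auto.
Qed.

Lemma approximates_comp f gs a :
  (forall b, exists c, approximates f b c) ->
  Forall (fun g => forall b, exists c, approximates g b c) gs ->
  exists c, approximates (TComp f gs) a c.
Proof.
  intros hf hgs. destruct (hf (length gs)) as [cf (tf & sf & ff)].
  assert (exists cs, Forall2 (fun g c => approximates g a c) gs cs) as [cs hcs].
  { clear - hgs. induction hgs as [|g gs hg _ [cs hcs]]; [eauto|].
    destruct (hg a) as [c hc]. eauto. }
  (* The product is nonzero exactly when every inner term has answered. *)
  set (prod := fun p e => fold_right (fun c w => c p e * w) 1 cs).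
  set (vals := fun p e => map (fun c : Baire -> list nat -> nat => pred (c p e)) cs).
  exists (fun p e => match prod p e with 0 => 0 | S _ => cf p (nth 0 e 0 :: vals p e) end).
  split; [|split].
  - apply tot_ifz.
    + unfold prod. clear - hcs. induction hcs as [|g c gs cs [hc _] _ IH]; simpl; auto with tot.
    + apply tot_const.
    + eapply tot_ext.
      * apply (tot_comp (S a) (S (length gs)) cf
          ((fun p e => nth 0 e 0) :: map (fun c p e => pred (c p e)) cs) tf).
        -- simpl. rewrite length_map. f_equal. symmetry. eapply Forall2_length; eauto.
        -- constructor; auto with tot. clear - hcs.
           induction hcs as [|g c gs cs [hc _] _ IH]; simpl; constructor; auto with tot.
      * intros p e _. simpl. rewrite map_map. reflexivity.
  - intros p m args v x hl e hx.
    destruct (prod p (m :: args)) eqn:hp; [discriminate|].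
    econstructor; [|apply (sf p m (vals p (m :: args)) v x); auto].
    + apply evals_Forall2. assert (hne : prod p (m :: args) <> 0) by lia.
      clear - hcs hne hl hx. unfold prod, vals in *. revert hne.
      induction hcs as [|g c gs cs [_ [hc _]] _ IH]; simpl; intros hne; constructor.
      * apply (hc p m); auto. destruct (c p (m :: args)); [elim hne; reflexivity | reflexivity].
      * apply IH. intros h0. apply hne. rewrite h0. lia.
    + unfold vals. rewrite length_map. symmetry. eapply Forall2_length; eauto.
  - intros p x args v hl he. inversion he as [| | | |? ? ? vs ? h1 h2| | |]; subst.
    apply evals_Forall2 in h1.
    assert (exists N, forall m, N <= length (word m) -> inB (S m) x ->
      prod p (m :: args) <> 0 /\ vals p (m :: args) = vs) as [N hN].
    { clear - hcs h1. unfold prod, vals. revert vs h1.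
      induction hcs as [|g c gs cs [_ [_ hc]] _ IH]; intros vs h1; inversion h1; subst; simpl.
      - exists 0; auto.
      - destruct (hc p x args y eq_refl) as [N hN]; [assumption|].
        destruct (IH l' ltac:(assumption)) as [N' hN'].
        exists (N + N'). intros m hm hx. rewrite (hN m) by (auto; lia).
        destruct (hN' m) as [h3 h4]; [lia|auto|]. split; [nia|]. rewrite h4. reflexivity. }
    destruct (ff p x vs v) as [N' hN']; auto.
    + apply Forall2_length in h1. auto.
    + exists (N + N'). intros m hm hx. destruct (hN m) as [h3 h4]; [lia|auto|].
      destruct (prod p (m :: args)) eqn:hp; [lia|]. rewrite h4. cbn [nth]. apply hN'; auto; lia.
Qed.

Lemma approximates_prim b s a :
  (forall a, exists c, approximates b a c) -> (forall a, exists c, approximates s a c) ->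
  exists c, approximates (TPrim b s) a c.
Proof.
  intros hb hs. destruct a as [|a].
  { exists (fun _ _ => 0). apply approximates_never.
    intros p [|] v hl h; [inversion h | discriminate]. }
  destruct (hb a) as [cb (tb & sb & fb)]. destruct (hs (S (S a))) as [cs (ts & ss & fs)].
  (* A missing answer at any stage of the recursion propagates as [0] to all later stages. *)
  set (rec := fun p m rest n => nat_rect (fun _ => nat) (cb p (m :: rest))
    (fun i w => match w with 0 => 0 | S w' => cs p (m :: i :: w' :: rest) end) n).
  exists (fun p e => rec p (nth 0 e 0) (skipn 2 e) (nth 1 e 0)). split; [|split].
  - set (step := fun p e => match nth 1 e 0 with
      | 0 => 0
      | S w => cs p (nth 2 e 0 :: nth 0 e 0 :: w :: skipn 4 e) end).
    apply (tot_rec (S (S a)) (fun p e => cb p (nth 0 e 0 :: skipn 2 e)) step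
      (fun p e => nth 1 e 0)); auto with tot.
    + apply (tot_select (S (S a)) cb 2 a tb); auto with tot.
    + apply (tot_case _ (fun p e => nth 1 e 0) (fun _ _ => 0)
        (fun p e => cs p (nth 3 e 0 :: nth 1 e 0 :: nth 0 e 0 :: skipn 5 e))); auto with tot.
      destruct ts as [t ht].
      exists (TComp t (TProj 3 :: TProj 1 :: TProj 0 :: map TProj (seq 5 a))).
      intros p e he. econstructor.
      * constructor; [constructor; lia|]. constructor; [constructor; lia|].
        constructor; [constructor; lia|]. apply evals_proj_seq. lia.
      * apply ht. cbn [length]. rewrite length_skipn. lia.
  - intros p m [|n rest] v x hl e hx; [discriminate|]. injection hl as hl.
    change (rec p m rest n = S v) in e. revert v e.
    induction n as [|n IH]; intros v e.
    + constructor. apply (sb p m); auto.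
    + change (match rec p m rest n with 0 => 0 | S w => cs p (m :: n :: w :: rest) end = S v)
        in e.
      destruct (rec p m rest n) as [|w] eqn:hw; [discriminate|].
      econstructor; [apply IH; reflexivity|]. apply (ss p m); simpl; auto.
  - intros p x [|n rest] v hl he; [discriminate|]. injection hl as hl.
    cbn [nth skipn]. revert v he. induction n as [|n IH]; intros v he; inversion he; subst.
    + destruct (fb p x rest v) as [N hN]; auto. exists N. auto.
    + destruct (IH w) as [N hN]; auto.
      destruct (fs p x (n :: w :: rest) v) as [N' hN']; auto.
      exists (N + N'). intros m hm hx.
      change (match rec p m rest n with 0 => 0 | S w => cs p (m :: n :: w :: rest) end = S v).
      rewrite hN by (auto; lia). apply hN'; auto; lia.
Qed.

Fixpoint least_upto (P : nat -> nat) (n : nat) : nat :=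
  match n with
  | 0 => 0
  | S n => match P (least_upto P n) with 0 => least_upto P n | S _ => S n end
  end.

Lemma least_upto_spec P n :
  least_upto P n <= n /\ (forall i, i < least_upto P n -> P i <> 0) /\
  (P (least_upto P n) = 0 \/ least_upto P n = n).
Proof.
  induction n as [|n (h1 & h2 & h3)]; simpl; [repeat split; auto; lia|].
  destruct (P (least_upto P n)) eqn:e; [auto|].
  destruct h3 as [h3|h3]; [lia|]. rewrite h3 in *. repeat split; auto.
  intros i hi. destruct (Nat.eq_dec i n) as [->|]; [lia | apply h2; lia].
Qed.

Lemma approximates_mu f a :
  (forall a, exists c, approximates f a c) -> exists c, approximates (TMu f) a c.
Proof.
  intros hf. destruct (hf (S a)) as [cf (tf & sf & ff)].
  (* This vanishes both for a missing answer and for the answer [0]. The bounded search halts at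
     either, and the final [match] accepts only the latter. *)
  set (stop := fun p m args n => cf p (m :: n :: args) - 1).
  set (first := fun p e => least_upto (stop p (nth 0 e 0) (skipn 1 e)) (nth 0 e 0)).
  assert (ht : forall k g, tot (k + S a) g ->
    tot (k + S a) (fun p e => cf p (nth k e 0 :: g p e :: skipn (S k) e))).
  { intros k g [s hs]. destruct tf as [t ht].
    exists (TComp t (TProj k :: s :: map TProj (seq (S k) a))). intros p e he. econstructor.
    - constructor; [constructor; lia|]. constructor; [apply hs; auto|].
      apply evals_proj_seq. lia.
    - apply ht. cbn [length]. rewrite length_skipn. lia. }
  assert (hfirst : tot (S a) first).
  (* The second factor vanishes at the bound [m], which makes the search total. *)
  { apply (tot_mu _ (fun p e =>
      (cf p (nth 1 e 0 :: nth 0 e 0 :: skipn 2 e) - 1) * (nth 1 e 0 - nth 0 e 0))).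
    - apply tot_mul; auto with tot. apply tot_sub; auto with tot.
      apply (ht 1 (fun p e => nth 0 e 0)). auto with tot.
    - intros p [|m args] hl; [discriminate|]. unfold first; cbn [nth skipn].
      fold (stop p m args (least_upto (stop p m args) m)).
      destruct (least_upto_spec (stop p m args) m) as (h1 & h2 & h3). split.
      + destruct h3 as [-> | ->]; lia.
      + intros i hi. specialize (h2 i hi). fold (stop p m args i). nia. }
  exists (fun p e =>
    match cf p (nth 0 e 0 :: first p e :: skipn 1 e) with
    | 0 => 0
    | S w => match w with 0 => S (first p e) | S _ => 0 end
    end).
  split; [|split].
  - eapply tot_ext with (f := fun p e =>
      match cf p (nth 0 e 0 :: first p e :: skipn 1 e) with
      | 0 => 0
      | S _ => match pred (cf p (nth 0 e 0 :: first p e :: skipn 1 e)) with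
               | 0 => S (first p e) | S _ => 0 end
      end).
    + pose proof (ht 0 first hfirst). simpl in *. auto with tot.
    + intros p e _. destruct (cf p _); reflexivity.
  - intros p m args v x hl e hx. cbn [nth skipn] in e. unfold first in e. cbn [nth skipn] in e.
    destruct (least_upto_spec (stop p m args) m) as (_ & h2 & _).
    set (n := least_upto (stop p m args) m) in *.
    destruct (cf p (m :: n :: args)) as [|[|]] eqn:hc; try discriminate.
    injection e as <-. constructor.
    + apply (sf p m); simpl; auto.
    + intros i hi. specialize (h2 i hi). unfold stop in h2. exists (cf p (m :: i :: args) - 2).
      apply (sf p m); simpl; auto. lia.
  - intros p x args v hl he. inversion he as [| | | | | | |? ? ? h1 h2]; subst.
    destruct (ff p x (v :: args) 0) as [N hN]; simpl; auto.
    destruct (bounded_max (fun i N => forall m, N <= length (word m) -> inB (S m) x ->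
      cf p (m :: i :: args) > 1)) with (n := v) as [N' hN'].
    + intros i j k hjk h m hm. apply h. lia.
    + intros i hi. destruct (h2 i hi) as [k hk].
      destruct (ff p x (i :: args) (S k)) as [M hM]; simpl; auto.
      exists M. intros m hm hx. rewrite hM; auto. lia.
    (* The summand [v] keeps the search bound [m] from cutting off before [v], as [m] is at least
       the length of [word m]. *)
    + exists (N + N' + v). intros m hm hx. cbn [nth skipn].
      assert (first p (m :: args) = v) as ->; [|rewrite hN; auto; lia].
      unfold first. cbn [nth skipn].
      destruct (least_upto_spec (stop p m args) m) as (h3 & h4 & h5).
      set (n := least_upto (stop p m args) m) in *.
      pose proof (length_word_le m).
      destruct (lt_eq_lt_dec n v) as [[hlt|heq]|hgt]; auto.
      * destruct h5 as [h5|h5]; [|lia]. unfold stop in h5.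
        specialize (hN' n hlt m). assert (cf p (m :: n :: args) > 1) by (apply hN'; auto; lia).
        lia.
      * elim (h4 v hgt). unfold stop. rewrite hN; auto. lia.
Qed.

Lemma approximates_ex t a : exists c, approximates t a c.
Proof.
  revert a. induction t using term_nested_ind; intros a.
  - exists (fun _ _ => 1). apply (approximates_total _ _ (fun _ _ => 0)); auto with tot.
    intros; constructor.
  - destruct a as [|a].
    + exists (fun _ _ => 0). apply approximates_never.
      intros p [|] v hl h; [inversion h | discriminate].
    + exists (fun p e => S (S (nth 1 e 0))).
      apply (approximates_total _ _ (fun _ e => S (nth 1 e 0))); auto with tot.
      intros q m [|y args] hl p; [discriminate | constructor].
  - destruct (le_lt_dec a i) as [hi|hi].
    + exists (fun _ _ => 0). apply approximates_never. intros p args v hl h; inversion h; lia.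
    + exists (fun p e => S (nth (S i) e 0)).
      apply (approximates_total _ _ (fun _ e => nth (S i) e 0)); auto with tot.
      intros q m args hl p. simpl. constructor. lia.
  - destruct a as [|a].
    { exists (fun _ _ => 0). apply approximates_never.
      intros p [|] v hl h; [inversion h | discriminate]. }
    (* Even queries go to [p]; odd ones read the word, where [lookup] already returns [0] past the
       end. *)
    exists (fun p e => if Nat.even (nth 1 e 0) then S (p (Nat.div2 (nth 1 e 0)))
                       else lookup (nth 0 e 0) (Nat.div2 (nth 1 e 0))).
    split; [auto 10 with tot|]. split.
    + intros p m [|y args] v x hl e hx; [discriminate|]. simpl in e.
      replace v with (bpair p x y); [constructor|]. unfold bpair.
      destruct (Nat.even y); [congruence|].
      apply inB_lookup with (i := Nat.div2 y) in hx. destruct hx; congruence.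
    + intros p x [|y args] v hl h; [discriminate|]. inversion h; subst.
      exists (S y). intros m hm hx. simpl. unfold bpair. destruct (Nat.even y); auto.
      apply inB_lookup with (i := Nat.div2 y) in hx. destruct hx as [hx|]; auto.
      rewrite lookup_word in hx. destruct (nth_error (word m) (Nat.div2 y)) eqn:e; [lia|].
      apply nth_error_None in e. pose proof (div2_le y). lia.
  - apply approximates_comp; auto.
  - apply approximates_prim; auto.
  - apply approximates_mu; auto.
Qed.

Definition closed_of (p : Baire) : Baire -> Prop := fun x => ~ exists n, inB (p n) x.

Definition total_computable (K : Baire -> Baire) : Prop := computable (fun p => Some (K p)).

Lemma tot_total_computable f : tot 1 f -> total_computable (fun p n => f p [n]).
Proof.
  intros [t ht]. exists t. intros p q [= <-] n. auto.
Qed.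

(* Enumerate every word on which the computation of [t] already halts. *)
Lemma closed_of_diverging t :
  exists K, total_computable K /\
    forall p x, closed_of (K p) x <-> ~ exists v, eval (bpair p x) t [] v.
Proof.
  destruct (approximates_ex t 0) as [c (tc & sc & fc)].
  (* The position [n] is also the code of the word being tried; the index [0] of the empty ball
     fills the positions where nothing has halted. *)
  exists (fun p n => match c p [n] with 0 => 0 | S _ => S n end). split.
  - apply (tot_total_computable (fun p e =>
      match c p (nth 0 e 0 :: skipn 1 e) with 0 => 0 | S _ => S (nth 0 e 0) end)).
    apply tot_ifz; auto with tot. apply (tot_select 1 c 1 0); auto with tot.
  - intros p x. unfold closed_of. apply not_iff_compat. split.
    + intros [n hn]. destruct (c p [n]) as [|v] eqn:e; [elim hn|].
      exists v. apply (sc p n); auto.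
    + intros [v hv]. destruct (fc p x [] v eq_refl hv) as [N hN].
      destruct (prefix_code x N) as [m [hm hx]]. exists m.
      assert (inB (S m) x) by (apply hx; intros i _; reflexivity).
      rewrite hN; auto. lia.
Qed.

(** * Closure properties of computable functionals *)

Lemma computable_comp H K :
  computable H -> computable K -> computable (fun p => obind (K p) H).
Proof.
  intros [t ht] [s hs]. exists (subst_oracle s t). intros p q e n.
  destruct (K p) as [k|] eqn:hk; [simpl in e|discriminate].
  apply (eval_subst_oracle p k); [apply hs, hk | apply ht, e].
Qed.

Lemma computable_bpair H K :
  computable H -> computable K ->
  computable (fun p => obind (H p) (fun a => obind (K p) (fun b => Some (bpair a b)))).
Proof.
  intros [t ht] [s hs].
  assert (tot 3 (fun _ e => if Nat.even (nth 0 e 0) then nth 1 e 0 else nth 2 e 0)) as [c hc]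
    by auto with tot.
  assert (tot 1 (fun _ e => Nat.div2 (nth 0 e 0))) as [d hd] by auto with tot.
  exists (TComp c [TProj 0; TComp t [d]; TComp s [d]]). intros p q e n.
  destruct (H p) as [a|] eqn:ha; [|discriminate].
  destruct (K p) as [b|] eqn:hb; [injection e as <-|discriminate].
  econstructor; [|exact (hc p [n; a (Nat.div2 n); b (Nat.div2 n)] eq_refl)].
  assert (evals p [d] [n] [Nat.div2 n]) by (constructor; [exact (hd p [n] eq_refl) | constructor]).
  constructor; [apply (ev_proj p 0 [n]); simpl; lia|].
  constructor; [econstructor; eauto; apply ht; auto|].
  constructor; [econstructor; eauto; apply hs; auto|constructor].
Qed.

Lemma total_computable_comp H K :
  total_computable H -> total_computable K -> total_computable (fun p => H (K p)).
Proof. apply (computable_comp (fun p => Some (H p)) (fun p => Some (K p))). Qed.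

Lemma total_computable_bpair H K :
  total_computable H -> total_computable K -> total_computable (fun p => bpair (H p) (K p)).
Proof. apply (computable_bpair (fun p => Some (H p)) (fun p => Some (K p))). Qed.

Lemma total_computable_id : total_computable (fun p => p).
Proof.
  apply (tot_total_computable (fun p e => p (nth 0 e 0))). auto with tot.
Qed.

Lemma total_computable_evens : total_computable evens.
Proof.
  apply (tot_total_computable (fun p e => p (2 * nth 0 e 0))). auto with tot.
Qed.

Lemma total_computable_odds : total_computable odds.
Proof.
  apply (tot_total_computable (fun p e => p (S (2 * nth 0 e 0)))). auto with tot.
Qed.

Definition succ_seq (p : Baire) : Baire := fun n => S (p n).
Definition pred_seq (p : Baire) : Baire := fun n => pred (p n).

Lemma total_computable_succ : total_computable succ_seq.
Proof.
  apply (tot_total_computable (fun p e => S (p (nth 0 e 0)))). auto with tot.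
Qed.

Lemma total_computable_pred : total_computable pred_seq.
Proof.
  apply (tot_total_computable (fun p e => pred (p (nth 0 e 0)))). auto with tot.
Qed.

Definition zeros : Baire := fun _ => 0.

Lemma total_computable_zeros : total_computable (fun _ => zeros).
Proof. apply (tot_total_computable (fun _ _ => 0)). auto with tot. Qed.

(** * Decoding names in the completion *)

Lemma tot_cnt a q g :
  tot (S a) q -> tot a g -> tot a (fun p e => cnt (fun i => q p (i :: e)) (g p e)).
Proof.
  intros hq hg. eapply tot_ext.
  - apply (tot_sum_below a (fun p e => match q p e with 0 => 0 | S _ => 1 end) g);
      auto with tot.
  - intros p e _; simpl. induction (g p e) as [|n IH]; [reflexivity|].
    simpl in *. rewrite <- IH. destruct (q p (n :: e)); reflexivity.
Qed.

Lemma cnt_le p i j : i <= j -> cnt p i <= cnt p j.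
Proof. induction 1; simpl; lia. Qed.

(** The count increases strictly past a nonzero letter, so it gives the position of that letter in
    [p - 1]. *)
Lemma cnt_inj p i j : p i <> 0 -> p j <> 0 -> cnt p i = cnt p j -> i = j.
Proof.
  assert (lt : forall i j, i < j -> p i <> 0 -> cnt p i < cnt p j).
  { intros i' j' h hi. apply (cnt_le p (S i') j') in h. simpl in h.
    destruct (Nat.eqb_spec (p i') 0); lia. }
  intros hi hj e. destruct (lt_eq_lt_dec i j) as [[h|h]|h]; auto.
  - specialize (lt i j h hi). lia.
  - specialize (lt j i h hj). lia.
Qed.

Lemma minus1_nth p x i : minus1 p x -> p i <> 0 -> x (cnt p i) = p i - 1.
Proof.
  intros h hi. destruct (h (cnt p i)) as (j & hj & hc & ->).
  rewrite (cnt_inj p j i); auto.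
Qed.

Lemma minus1_unique p x y : minus1 p x -> minus1 p y -> x = y.
Proof.
  intros hx hy. extensionality k. destruct (hx k) as (i & hi & <- & ->).
  symmetry. apply minus1_nth; auto.
Qed.

(** A name in the completion may be delayed by any number of zeros, so its first [j] letters need
    carry no information. *)
Lemma minus1_shift j x : minus1 (fun i => if i <? j then 0 else S (x (i - j))) x.
Proof.
  set (p := fun i => _).
  assert (hc : forall i, cnt p i = i - j).
  { induction i as [|i IH]; auto.
    change (cnt p i + (if p i =? 0 then 0 else 1) = S i - j). rewrite IH. unfold p.
    destruct (Nat.ltb_spec i j); cbn [Nat.eqb]; lia. }
  intros k. exists (k + j). rewrite hc. unfold p.
  destruct (Nat.ltb_spec (k + j) j); [lia|]. replace (k + j - j) with k by lia. lia.
Qed.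

Lemma minus1_succ x : minus1 (succ_seq x) x.
Proof.
  replace (succ_seq x) with (fun i => if i <? 0 then 0 else S (x (i - 0)))
    by (extensionality i; rewrite Nat.sub_0_r; reflexivity).
  apply minus1_shift.
Qed.

Definition decode (p : Baire) : option Baire :=
  match excluded_middle_informative (exists x, minus1 p x) with
  | left h => Some (proj1_sig (constructive_indefinite_description _ h))
  | right _ => None
  end.

Lemma decode_Some p x : decode p = Some x <-> minus1 p x.
Proof.
  unfold decode. destruct (excluded_middle_informative _) as [h|h].
  - destruct (constructive_indefinite_description _ h) as [y hy]; simpl. split.
    + intros [= <-]. exact hy.
    + intros hx. f_equal. eapply minus1_unique; eauto.
  - split; [discriminate|]. intros hx. elim h; eauto.
Qed.

Lemma computable_decode : computable decode.
Proof.
  (* The sum is zero exactly at the position of the nonzero letter that becomes letter [n] of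
     [p - 1]. *)
  assert (tot 2 (fun p e => (1 - p (nth 0 e 0)) + eq_test (cnt p (nth 0 e 0)) (nth 1 e 0)))
    as [t ht].
  { apply tot_add; [|apply tot_eq_test]; auto with tot.
    apply (tot_cnt 2 (fun p e => p (nth 0 e 0))); auto with tot. }
  assert (tot 1 (fun p e => pred (p (nth 0 e 0)))) as [s hs] by auto with tot.
  exists (TComp s [TMu t]). intros p x e n. apply decode_Some in e.
  destruct (e n) as (i & hi & hc & hx).
  replace (x n) with (pred (p i)) by lia.
  econstructor; [|exact (hs p [i] eq_refl)]. constructor; [|constructor].
  assert (hv : forall j, eval p t [j; n] ((1 - p j) + eq_test (cnt p j) n))
    by (intro j; exact (ht p [j; n] eq_refl)).
  constructor.
  - replace 0 with ((1 - p i) + eq_test (cnt p i) n); auto.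
    rewrite hc. unfold eq_test. lia.
  - intros j hj. exists (pred ((1 - p j) + eq_test (cnt p j) n)).
    replace (S (pred _)) with ((1 - p j) + eq_test (cnt p j) n); auto.
    destruct (Nat.eq_dec (p j) 0) as [->|hpj]; [simpl; lia|].
    destruct (Nat.eq_dec (cnt p j) n) as [hcj|hcj].
    + rewrite (cnt_inj p j i) in hj by congruence. lia.
    + unfold eq_test. lia.
Qed.

(** Padding zeros stay [0], the index of the empty ball, and so remove nothing. Unlike [decode],
    [pred_seq] is total and yields a closed set even from a name of bottom. *)
Lemma closed_of_pred p q x : minus1 p q -> closed_of (pred_seq p) x <-> closed_of q x.
Proof.
  intros h. unfold closed_of. apply not_iff_compat. split; intros [n hn].
  - exists (cnt p n). rewrite (minus1_nth p q n); auto.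
    + unfold pred_seq in hn. rewrite Nat.sub_1_r. exact hn.
    + intros e. unfold pred_seq in hn. rewrite e in hn. exact hn.
  - destruct (h n) as (i & hi & hc & e). exists i. unfold pred_seq.
    rewrite e, Nat.sub_1_r in hn. exact hn.
Qed.

Lemma closed_of_bpair p q x : closed_of (bpair p q) x <-> closed_of p x /\ closed_of q x.
Proof.
  unfold closed_of. split.
  - intros h. split; intros [n hn]; apply h.
    + exists (2 * n). rewrite bpair_even. exact hn.
    + exists (S (2 * n)). rewrite bpair_odd. exact hn.
  - intros [hp hq] [n hn]. unfold bpair in hn. destruct (Nat.even n); eauto.
Qed.

(** * Weihrauch reductions *)

Lemma Wred_intro {X Y X' Y'} (f : problem X Y) (g : problem X' Y') H K :
  computable H -> computable K ->
  (forall p x, delta X p x -> dom f x -> exists k x', K p = Some k /\ delta X' k x' /\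
     dom g x' /\ forall q y', delta Y' q y' -> g x' y' ->
       exists r, H (bpair p q) = Some r /\ exists y, delta Y r y /\ f x y) ->
  Wred f g.
Proof.
  intros hH hK h. exists H, K. do 2 (split; [assumption|]). intros G hG p x hx hd.
  destruct (h p x hx hd) as (k & x' & hk & hx' & hd' & hh).
  destruct (hG k x' hx' hd') as (q & hq & y' & hy' & hg).
  destruct (hh q y' hy' hg) as (r & hr & hy).
  exists r. rewrite hk; simpl. rewrite hq; simpl. auto.
Qed.

(* [delta] may be multi-valued, so an answer must suit all the instances named by [k]. *)
Definition answers {X Y} (g : problem X Y) (k q : Baire) : Prop :=
  forall x, delta X k x -> dom g x -> exists y, delta Y q y /\ g x y.

(** If [g] had no realizer, every reduction to it would hold vacuously and nothing could be
    extracted from it. *)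
Definition realizable {X Y} (g : problem X Y) : Prop :=
  forall k, (exists x, delta X k x /\ dom g x) -> exists q, answers g k q.

(** The quantifier over realizers is traded for one over answers to a single query: a fixed realizer
    can be altered at [k] alone to return any admissible [q]. *)
Lemma Wred_elim {X Y X' Y'} (f : problem X Y) (g : problem X' Y') :
  realizable g -> Wred f g ->
  exists H K, computable H /\ computable K /\
  forall p x, delta X p x -> dom f x -> exists k, K p = Some k /\
    (exists x', delta X' k x' /\ dom g x') /\
    forall q, answers g k q ->
      exists r, H (bpair p q) = Some r /\ exists y, delta Y r y /\ f x y.
Proof.
  intros hg (H & K & hH & hK & h). exists H, K. do 2 (split; [assumption|]).
  intros p x hx hd.
  (* This realizer is undefined off the names of instances, which forces [K p] to be such a name. *)
  destruct (choice (fun k (o : option Baire) =>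
    match o with
    | Some q => (exists x, delta X' k x /\ dom g x) /\ answers g k q
    | None => ~ exists x, delta X' k x /\ dom g x
    end)) as [G hG].
  { intros k. destruct (classic (exists x, delta X' k x /\ dom g x)) as [e|e].
    - destruct (hg k e) as [q hq]. exists (Some q). auto.
    - exists None. exact e. }
  assert (hk : exists k, K p = Some k /\ exists x', delta X' k x' /\ dom g x').
  { destruct (h G) with (p := p) (x := x) as (r & hr & _); auto.
    - intros k x' hx' hd'. specialize (hG k). destruct (G k) as [q|].
      + exists q. split; auto. apply hG; auto.
      + elim hG; eauto.
    - destruct (K p) as [k|]; [|discriminate]. simpl in hr. exists k. split; auto.
      specialize (hG k). destruct (G k); [apply hG | discriminate]. }
  destruct hk as (k & hk & hx'). exists k. do 2 (split; [assumption|]). intros q hq.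
  destruct (h (fun k' => if excluded_middle_informative (k' = k) then Some q else G k'))
    with (p := p) (x := x) as (r & hr & hy); auto.
  - intros k' x' hkx' hd'. destruct (excluded_middle_informative (k' = k)) as [->|_].
    + exists q. split; auto.
    + specialize (hG k'). destruct (G k') as [q'|].
      * exists q'. split; auto. apply hG; auto.
      * elim hG; eauto.
  - exists r. split; auto. rewrite hk in hr; simpl in hr.
    destruct (excluded_middle_informative (k = k)); [exact hr | contradiction].
Qed.

Lemma Wred_trans {X1 Y1 X2 Y2 X3 Y3} (f : problem X1 Y1) (g : problem X2 Y2)
    (h : problem X3 Y3) : Wred f g -> Wred g h -> Wred f h.
Proof.
  intros (H1 & K1 & hH1 & hK1 & r1) (H2 & K2 & hH2 & hK2 & r2).
  (* The outer functional sees only the input and the last answer; it recomputes the intermediate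
     query [K1 p], which [H2] needs. *)
  set (pr := fun p => obind (obind (Some (evens p)) K1)
    (fun a => obind (Some (odds p)) (fun b => Some (bpair a b)))).
  set (inner := fun p => obind (pr p) H2).
  set (outer := fun p => obind (Some (evens p)) (fun a => obind (inner p)
    (fun b => Some (bpair a b)))).
  exists (fun p => obind (outer p) H1), (fun p => obind (K1 p) K2). split; [|split].
  - apply computable_comp; auto. apply (computable_bpair (fun p => Some (evens p)) inner).
    + apply total_computable_evens.
    + apply computable_comp; auto.
      apply (computable_bpair (fun p => obind (Some (evens p)) K1) (fun p => Some (odds p))).
      * apply (computable_comp K1 (fun p => Some (evens p))); auto.
        apply total_computable_evens.
      * apply total_computable_odds.
  - apply computable_comp; auto.
  - intros G hG p x hx hd.
    destruct (r1 _ (r2 G hG) p x hx hd) as (q & hq & hy). exists q. split; auto.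
    rewrite <- hq. unfold outer, inner, pr. destruct (K1 p) as [k1|] eqn:e1; simpl; auto.
    destruct (K2 k1) as [k2|]; simpl; auto.
    destruct (G k2) as [r|]; simpl; auto.
    rewrite !evens_bpair, !odds_bpair, e1; simpl.
    destruct (H2 (bpair k1 r)); reflexivity.
Qed.

(** * Answers and realizability for choice and its total versions *)

Lemma delta_closed_of k : delta ClosedSp k (closed_of k).
Proof. intros x; reflexivity. Qed.

Lemma delta_BaireSp p : delta BaireSp p p.
Proof. intros n; reflexivity. Qed.

Lemma delta_BaireSp_eq p x : delta BaireSp p x -> x = p.
Proof. intros h. extensionality n. apply h. Qed.

Lemma completion_named X q : exists ox, delta (completion X) q ox.
Proof.
  destruct (classic (exists q' x, minus1 q q' /\ delta X q' x)) as [(q' & x & h)|h].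
  - exists (Some x). exists q'. exact h.
  - exists None. exact h.
Qed.

Lemma answers_CB k q : closed_of k q -> answers CB k q.
Proof. intros h A hA _. exists q. split; [apply delta_BaireSp | apply hA, h]. Qed.

Lemma realizable_CB : realizable CB.
Proof.
  intros k (A & hA & x & hx). exists x. apply answers_CB. apply hA, hx.
Qed.

Lemma dom_Tot {X Y} (f : problem X Y) (y : carrier Y) x : dom (Tot f) x.
Proof.
  destruct (classic (dom f x)) as [[z hz]|h]; [exists z; intro; exact hz|].
  exists y. intro; contradiction.
Qed.

Lemma answers_Tot_CB k q :
  ((exists x, closed_of k x) -> closed_of k q) -> answers (Tot CB) k q.
Proof.
  intros h A hA _. exists q. split; [apply delta_BaireSp|].
  intros [x hx]. apply hA, h. exists x. apply hA, hx.
Qed.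

Lemma realizable_Tot_CB : realizable (Tot CB).
Proof.
  intros k _. destruct (classic (exists x, closed_of k x)) as [[x hx]|h].
  - exists x. apply answers_Tot_CB. auto.
  - exists zeros. apply answers_Tot_CB. intro; contradiction.
Qed.

Lemma dom_pbar {X Y} (f : problem X Y) x : dom (pbar f) x.
Proof.
  destruct x as [x|]; [|exists None; exact I].
  destruct (classic (dom f x)) as [[y hy]|h].
  { exists (Some y). intros _. exists y. auto. }
  exists None. intro; contradiction.
Qed.

(** Only nonempty closed sets constrain the answer; otherwise any [q] will do, since every sequence
    names a point of the completion. *)
Lemma answers_pbar_CB k q :
  (forall k', minus1 k k' -> (exists x, closed_of k' x) ->
     exists x, minus1 q x /\ closed_of k' x) -> answers (pbar CB) k q.
Proof.
  intros h [A|] hA _.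
  - destruct hA as (k' & hk & hA). destruct (classic (exists x, closed_of k' x)) as [e|e].
    + destruct (h k' hk e) as (x & hx & hc). exists (Some x). split.
      * exists x. split; auto. apply delta_BaireSp.
      * intros _. exists x. split; auto. apply hA, hc.
    + destruct (completion_named BaireSp q) as [oy hoy]. exists oy. split; auto.
      intros [x hx]. elim e. exists x. apply hA, hx.
  - destruct (completion_named BaireSp q) as [oy hoy]. exists oy. split; auto. exact I.
Qed.

Lemma realizable_pbar_CB : realizable (pbar CB).
Proof.
  intros k _. destruct (classic (exists k' x, minus1 k k' /\ closed_of k' x)) as
    [(k' & x & hk & hx)|h].
  - exists (succ_seq x). apply answers_pbar_CB. intros k'' hk'' _.
    rewrite (minus1_unique _ _ _ hk'' hk). exists x. auto using minus1_succ.
  - exists zeros. apply answers_pbar_CB. intros k' hk [x hx]. elim h; eauto.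
Qed.

(** * Positive reductions *)

Lemma CB_le_pbar_CB : Wred CB (pbar CB).
Proof.
  apply (Wred_intro _ _ (fun p => obind (Some (odds p)) decode) (fun p => Some (succ_seq p))).
  - apply computable_comp; [apply computable_decode | apply total_computable_odds].
  - apply total_computable_succ.
  - intros p A hA hd. exists (succ_seq p), (Some A). do 2 (split; auto).
    { exists p. auto using minus1_succ. }
    split; [apply dom_pbar|]. intros q y hq hy. destruct (hy hd) as (x & -> & hx).
    destruct hq as (q' & hq & e). simpl. rewrite odds_bpair.
    exists q'. split; [apply decode_Some; auto|]. exists x. auto.
Qed.

(** [pred_seq] turns any query into a genuine, possibly empty, closed set; when that set is not
    constrained, any output is acceptable. *)
Lemma pbar_CB_le_Tot_CB : Wred (pbar CB) (Tot CB).
Proof.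
  apply (Wred_intro _ _ (fun p => Some (succ_seq (odds p))) (fun p => Some (pred_seq p))).
  - apply total_computable_comp; [apply total_computable_succ | apply total_computable_odds].
  - apply total_computable_pred.
  - intros p oA hA _. exists (pred_seq p), (closed_of (pred_seq p)).
    do 2 (split; [auto using delta_closed_of|]). split; [exact (dom_Tot CB zeros _)|].
    intros q x hq hx. apply delta_BaireSp_eq in hq as ->. rewrite odds_bpair.
    exists (succ_seq q). split; auto. destruct oA as [A|].
    + destruct hA as (k & hk & hA). exists (Some q). split.
      * exists q. split; [apply minus1_succ | apply delta_BaireSp].
      * intros [y hy]. exists q. split; auto. apply hA, (closed_of_pred _ _ _ hk), hx.
        exists y. apply (closed_of_pred _ _ _ hk), hA, hy.
    + destruct (completion_named BaireSp (succ_seq q)) as [oy hoy]. exists oy.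
      split; auto. exact I.
Qed.

Lemma closed_problem_le_CB K :
  total_computable K -> @Wred BaireSp BaireSp ClosedSp BaireSp (fun s z => closed_of (K s) z) CB.
Proof.
  intros hK. apply (Wred_intro _ _ (fun v => Some (odds v)) (fun s => Some (K s)));
    [apply total_computable_odds | exact hK|].
  intros p x hx [z hz]. apply delta_BaireSp_eq in hx as ->.
  exists (K p), (closed_of (K p)). do 2 (split; [auto using delta_closed_of|]).
  split; [exists z; exact hz|]. intros q y hq hy. apply delta_BaireSp_eq in hq as ->.
  rewrite odds_bpair. exists q. split; auto. exists q. split; [apply delta_BaireSp | exact hy].
Qed.

Lemma eval_mu_total o b g :
  (forall n, eval o b [n] (g n)) -> (exists v, eval o (TMu b) [] v) <-> exists n, g n = 0.
Proof.
  intros h. split.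
  - intros [v hv]. inversion hv as [| | | | | | |? ? ? h1 h2]; subst.
    exists v. eapply eval_det; eauto.
  - intros [n hn]. exists (least_upto g n).
    destruct (least_upto_spec g n) as (_ & h2 & h3). constructor.
    + replace 0 with (g (least_upto g n)); auto. destruct h3 as [|h3]; [auto | rewrite h3; auto].
    + intros m hm. specialize (h2 m hm). exists (pred (g m)).
      replace (S (pred (g m))) with (g m) by lia. apply h.
Qed.

(** Membership fails exactly when the search for a zero of [f] halts, so [closed_of_diverging]
    applies to that search. *)
Lemma closed_of_decidable f :
  tot 1 f -> exists K, total_computable K /\
    forall p x, closed_of (K p) x <-> forall n, f (bpair p x) [n] <> 0.
Proof.
  intros [t ht]. destruct (closed_of_diverging (TMu t)) as (K & hK & h).
  exists K. split; auto. intros p x. rewrite h.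
  rewrite (eval_mu_total _ t (fun n => f (bpair p x) [n])) by (intros n; apply ht; auto).
  split; [intros h1 n e; eauto | intros h1 [n e]; elim (h1 n e)].
Qed.

(* Such an [x] is the only candidate for [r - 1] when [r - 1] is infinite; otherwise it is
   an arbitrary continuation of the finite word [r - 1]. *)
Definition extends_minus1 (r x : Baire) : Prop :=
  forall i, r i <> 0 -> x (cnt r i) = r i - 1.

Lemma extends_minus1_ex r : exists x, extends_minus1 r x.
Proof.
  destruct (choice (fun k v => forall i, r i <> 0 -> cnt r i = k -> v = r i - 1)) as [x hx].
  - intros k. destruct (classic (exists i, r i <> 0 /\ cnt r i = k)) as [(i & hi & hk)|h].
    + exists (r i - 1). intros j hj hk'. rewrite (cnt_inj r i j); congruence.
    + exists 0. intros i hi hk. elim h; eauto.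
  - exists x. intros i hi. auto.
Qed.

Lemma extends_minus1_minus1 r x y : extends_minus1 r x -> minus1 r y -> x = y.
Proof.
  intros hx hy. extensionality k. destruct (hy k) as (i & hi & <- & ->). auto.
Qed.

(** Only the even half of [z] is constrained; the odd half is left free for a further choice. *)
Lemma closed_of_extends_minus1 :
  exists K, total_computable K /\
    forall r z, closed_of (K r) z <-> extends_minus1 r (evens z).
Proof.
  destruct (closed_of_decidable (fun o e => match o (2 * nth 0 e 0) with
    | 0 => 1
    | S _ => 1 - eq_test (o (S (2 * (2 * cnt (fun i => o (2 * i)) (nth 0 e 0)))))
                         (o (2 * nth 0 e 0) - 1) end)) as (K & hK & h).
  - apply tot_ifz; auto 20 with tot. apply tot_sub; auto with tot.
    apply tot_eq_test; auto 20 with tot. apply tot_oracle, tot_S.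
    do 2 (apply tot_mul; auto 20 with tot).
    apply (tot_cnt 1 (fun o e => o (2 * nth 0 e 0))); auto 20 with tot.
  - exists K. split; auto. intros r z. rewrite h. unfold extends_minus1.
    fold (evens (bpair r z)). rewrite evens_bpair.
    assert (e : forall i, match bpair r z (2 * nth 0 [i] 0) with
      | 0 => 1
      | S _ => 1 - eq_test (bpair r z (S (2 * (2 * cnt r (nth 0 [i] 0)))))
                         (bpair r z (2 * nth 0 [i] 0) - 1) end =
      match r i with 0 => 1 | S _ => 1 - eq_test (evens z (cnt r i)) (r i - 1) end).
    { intros i. cbn [nth]. rewrite bpair_even, bpair_odd. reflexivity. }
    split.
    + intros h1 i hi. specialize (h1 i). rewrite e in h1. apply eq_test_0.
      destruct (r i); [congruence|]. lia.
    + intros h1 i. rewrite e. specialize (h1 i). destruct (r i); [lia|].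
      rewrite (proj2 (eq_test_0 _ _)) by auto. lia.
Qed.

(** The second choice picks a pair: a continuation of [r - 1], used as the answer of [Tot CB], and a
    solution of the query that [f0] then makes. If the first set is nonempty the continuation is
    forced and correct; if it is empty, every continuation is allowed. *)
Lemma comp_Tot_CB_le_comp_pbar_CB {X Y Z} (f0 : problem Y Z) (g0 : problem X Y) :
  Wred f0 CB -> Wred g0 (Tot CB) ->
  exists f1 g1 : problem BaireSp BaireSp,
    Wred f1 CB /\ Wred g1 (pbar CB) /\ Wred (pcomp f0 g0) (pcomp f1 g1).
Proof.
  intros hf hg.
  destruct (Wred_elim _ _ realizable_CB hf) as (H1 & K1 & cH1 & cK1 & r1).
  destruct (Wred_elim _ _ realizable_Tot_CB hg) as (H0 & K0 & cH0 & cK0 & r0).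
  (* With [o] of the form [bpair (bpair p r) (bpair x y)], this is the query of [f0] after [x] has
     been taken as the answer for [g0]. *)
  set (inst := fun o => obind (obind
    (Some (bpair (evens (evens o)) (evens (odds o)))) H0) K1).
  assert (cinst : computable inst).
  { apply computable_comp; auto.
    apply (computable_comp H0 (fun o => Some (bpair (evens (evens o)) (evens (odds o)))));
      auto.
    apply total_computable_bpair; apply total_computable_comp;
      auto using total_computable_evens, total_computable_odds. }
  destruct cinst as [ti hi].
  assert (tot 1 (fun o e => inB_test (nth 0 e 0) (odds (odds o)))) as [tb hb].
  { apply (tot_inB_test 1 _ (fun o e => o (S (2 * S (2 * nth 0 e 0))))); auto 20 with tot. }
  destruct (closed_of_diverging (TMu (TComp tb [ti]))) as (KT & cKT & hKT).
  destruct closed_of_extends_minus1 as (KE & cKE & hKE).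
  assert (closed_KT : forall s z k, inst (bpair s z) = Some k ->
    closed_of (KT s) z <-> closed_of k (odds z)).
  { intros s z k e. rewrite hKT. unfold closed_of. apply not_iff_compat.
    rewrite (eval_mu_total _ _ (fun n => inB_test (k n) (odds z))).
    - split; intros [n hn]; exists n; apply inB_test_0; auto.
    - intros n. econstructor.
      + constructor; [apply (hi _ _ e) | constructor].
      + pose proof (hb (bpair s z) [k n] eq_refl) as h. rewrite odds_bpair in h. exact h. }
  set (f1 := (fun s z => closed_of (bpair (KE (odds s)) (KT s)) z) : problem BaireSp BaireSp).
  (* The input is passed along because [f1] needs it to run [H0]. *)
  set (g1 := (fun p s => exists k r, K0 p = Some k /\ s = bpair p r /\
    ((exists x, closed_of k x) -> exists x, minus1 r x /\ closed_of k x))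
    : problem BaireSp BaireSp).
  exists f1, g1. split; [|split].
  - apply (closed_problem_le_CB (fun s => bpair (KE (odds s)) (KT s))).
    apply total_computable_bpair; auto.
    apply total_computable_comp; auto using total_computable_odds.
  - apply (Wred_intro _ _ (fun v => Some v) (fun p => obind (K0 p) (fun k => Some (succ_seq k)))).
    + apply total_computable_id.
    + apply (computable_comp (fun k => Some (succ_seq k)) K0); auto.
      apply total_computable_succ.
    + intros p x hx (s & k & r & hk & _). apply delta_BaireSp_eq in hx as ->.
      exists (succ_seq k), (Some (closed_of k)). rewrite hk.
      split; [reflexivity|]. split.
      { exists k. auto using minus1_succ, delta_closed_of. }
      split; [apply dom_pbar|]. intros q oy hq hy. exists (bpair p q). split; auto.
      exists (bpair p q). split; [apply delta_BaireSp|]. exists k, q. do 2 (split; auto).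
      intros hn. destruct (hy hn) as (y & -> & hy'). destruct hq as (q' & hq & hd).
      apply delta_BaireSp_eq in hd as ->. eauto.
  - (* any continuation of [r - 1] is a legitimate answer for [g0] *)
    assert (valid : forall p x k r z, delta X p x -> dom (pcomp f0 g0) x -> K0 p = Some k ->
      ((exists x, closed_of k x) -> exists x, minus1 r x /\ closed_of k x) ->
      extends_minus1 r (evens z) ->
      exists u k1, H0 (bpair p (evens z)) = Some u /\ K1 u = Some k1 /\
        (exists y, closed_of k1 y) /\
        forall y, closed_of k1 y -> exists out, H1 (bpair u y) = Some out /\
          exists z, delta Z out z /\ pcomp f0 g0 x z).
    { intros p x k r z hx [z0 [hd (y0 & hy0 & hz0)]] hk hr he.
      destruct (r0 p x hx (ex_intro _ y0 hy0)) as (k' & hk' & _ & ha).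
      replace k' with k in * by congruence.
      destruct (ha (evens z)) as (u & hu & y & hy & hgy).
      { apply answers_Tot_CB. intros hn. destruct (hr hn) as (w & hw & hc).
        rewrite (extends_minus1_minus1 r (evens z) w); auto. }
      destruct (r1 u y hy (hd y hgy)) as (k1 & hk1 & hne & ha1).
      exists u, k1. do 2 (split; [assumption|]). split.
      - destruct hne as (A & hA & w & hw). exists w. apply hA, hw.
      - intros w hw. destruct (ha1 w (answers_CB _ _ hw)) as (out & ho & v & hv & hfv).
        exists out. split; auto. exists v. split; auto. split; eauto. }
    apply (Wred_intro _ _
      (fun v => obind (obind (obind (Some (bpair (evens v) (evens (odds v)))) H0)
         (fun u => obind (Some (odds (odds v))) (fun y => Some (bpair u y)))) H1)
      (fun p => Some p)).
    + apply computable_comp; auto.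
      apply (computable_bpair (fun v => obind (Some (bpair (evens v) (evens (odds v)))) H0)
        (fun v => Some (odds (odds v)))).
      * apply (computable_comp H0 (fun v => Some (bpair (evens v) (evens (odds v))))); auto.
        apply total_computable_bpair; [apply total_computable_evens|].
        apply total_computable_comp;
          auto using total_computable_evens, total_computable_odds.
      * apply total_computable_comp; apply total_computable_odds.
    + apply total_computable_id.
    + intros p x hx hd. exists p, p. split; auto. split; [apply delta_BaireSp|].
      (* The domain of [pcomp] requires that every output of [g1], including those with [r - 1]
         finite, be solvable by [f1]. *)
      assert (domf : forall s, g1 p s -> dom f1 s).
      { intros s (k & r & hk & -> & hr). destruct (extends_minus1_ex r) as [w hw].
        destruct (valid p x k r (bpair w w) hx hd hk hr) as (u & k1 & hu & hk1 & [y hy] & _).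
        { rewrite evens_bpair. exact hw. }
        exists (bpair w y). apply closed_of_bpair. rewrite odds_bpair. split.
        - apply hKE. rewrite evens_bpair. exact hw.
        - apply (closed_KT _ _ k1); [|rewrite odds_bpair; exact hy].
          unfold inst. rewrite evens_bpair in hu. rewrite evens_bpair, odds_bpair, !evens_bpair.
          simpl. rewrite hu. exact hk1. }
      split.
      * assert (exists s, g1 p s) as [s hs].
        { destruct hd as [z0 [_ (y0 & hy0 & _)]].
          destruct (r0 p x hx (ex_intro _ y0 hy0)) as (k & hk & _).
          destruct (classic (exists x, closed_of k x)) as [[w hw]|hn].
          - exists (bpair p (succ_seq w)), k, (succ_seq w). do 2 (split; auto).
            intros _. exists w. auto using minus1_succ.
          - exists (bpair p zeros), k, zeros. do 2 (split; auto). intro; contradiction. }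
        destruct (domf s hs) as [z hz]. exists z. split; auto. exists s. auto.
      * intros q z hq [_ (s & (k & r & hk & -> & hr) & hz)].
        apply delta_BaireSp_eq in hq as ->.
        apply closed_of_bpair in hz as [hz1 hz2]. rewrite odds_bpair in hz1.
        apply hKE in hz1.
        destruct (valid p x k r q hx hd hk hr hz1) as (u & k1 & hu & hk1 & _ & ha).
        apply (closed_KT _ _ k1) in hz2.
        -- destruct (ha _ hz2) as (out & ho & hout). exists out. split; auto. simpl.
           rewrite evens_bpair, odds_bpair, hu. exact ho.
        -- unfold inst. rewrite evens_bpair, odds_bpair, evens_bpair. simpl.
           rewrite hu. exact hk1.
Qed.

(** The identity is below [CB], by asking for a point of the whole space, so it can serve as outer
    factor. *)
Lemma Tot_CB_le_comp :
  exists f0 : problem BaireSp BaireSp, Wred f0 CB /\ Wred (Tot CB) (pcomp f0 (Tot CB)).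
Proof.
  exists (fun x y => x = y). split.
  - apply (Wred_intro _ _ (fun v => Some (evens v)) (fun _ => Some zeros)).
    + apply total_computable_evens.
    + apply total_computable_zeros.
    + intros p x hx _. exists zeros, (closed_of zeros). split; auto.
      split; [apply delta_closed_of|]. split.
      { exists zeros. intros [n []]. }
      intros q y _ _. exists p. rewrite evens_bpair. split; auto. exists x. auto.
  - apply (Wred_intro _ _ (fun v => Some (odds v)) (fun p => Some p)).
    + apply total_computable_odds.
    + apply total_computable_id.
    + intros p A hA [y hy]. exists p, A. do 2 (split; auto). split.
      { exists y. split; [intros z _; exists z; reflexivity | exists y; auto]. }
      intros q z hq (_ & w & hw & ->). exists q. rewrite odds_bpair. split; eauto.
Qed.

Definition nonempty_test : problem BaireSp BaireSp :=
  fun p q => q 0 = 0 <-> exists x, closed_of p x.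

(** [Tot CB] supplies a point that belongs to the set unless the set is empty; the outer [CB] only
    has to decide whether this point belongs. *)
Lemma nonempty_test_le_comp :
  exists (f0 g0 : problem BaireSp BaireSp),
    Wred f0 CB /\ Wred g0 (Tot CB) /\ Wred nonempty_test (pcomp f0 g0).
Proof.
  (* On input [<p, x>] an answer [q] is [0...] if [x] lies in the closed set named by [p],
     and otherwise [q 0 - 1] is the index of a ball that excludes [x]. *)
  destruct (closed_of_decidable (fun o e =>
    match odds o 0 with
    | 0 => inB_test (o (2 * (2 * nth 0 e 0))) (odds (evens o))
    | S j => 1 - inB_test (o (2 * (2 * j))) (odds (evens o))
    end)) as (K & cK & hK).
  { assert (tot 1 (fun o e => inB_test (o (2 * (2 * nth 0 e 0))) (odds (evens o)))).
    { apply (tot_inB_test 1 _ (fun o e => o (2 * S (2 * nth 0 e 0)))); auto 20 with tot. }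
    unfold odds at 1. apply (tot_case 1 (fun o e => o (S (2 * 0))) _
      (fun o e => 1 - inB_test (o (2 * (2 * nth 0 e 0))) (odds (evens o)))); auto 20 with tot.
    apply tot_sub; auto 20 with tot.
    apply (tot_inB_test 2 _ (fun o e => o (2 * S (2 * nth 0 e 0)))); auto 20 with tot. }
  assert (hK' : forall p x q, closed_of (K (bpair p x)) q <->
    match q 0 with 0 => closed_of p x | S j => inB (p j) x end).
  { intros p x q. rewrite hK. rewrite odds_bpair, evens_bpair, odds_bpair.
    assert (e : forall n, bpair (bpair p x) q (2 * (2 * n)) = p n)
      by (intros; rewrite !bpair_even; reflexivity).
    destruct (q 0) as [|j].
    - unfold closed_of. split.
      + intros h [n hn]. apply (h n). rewrite e. apply inB_test_0, hn.
      + intros h n h0. apply h. exists n. rewrite e in h0. apply inB_test_0, h0.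
    - rewrite e. rewrite <- inB_test_0. split; [intros h; specialize (h 0); lia | intros; lia]. }
  set (f0 := (fun s q => closed_of (K s) q) : problem BaireSp BaireSp).
  set (g0 := (fun p s => exists x, s = bpair p x /\
    ((exists y, closed_of p y) -> closed_of p x)) : problem BaireSp BaireSp).
  exists f0, g0. split; [apply closed_problem_le_CB; auto|]. split.
  - apply (Wred_intro _ _ (fun v => Some v) (fun p => Some p));
      try apply total_computable_id.
    intros p x hx _. apply delta_BaireSp_eq in hx as ->. exists p, (closed_of p).
    do 2 (split; [auto using delta_closed_of|]). split; [exact (dom_Tot CB zeros _)|].
    intros q y hq hy. apply delta_BaireSp_eq in hq as ->. exists (bpair p q). split; auto.
    exists (bpair p q). split; [apply delta_BaireSp|]. exists q. auto.
  - apply (Wred_intro _ _ (fun v => Some (odds v)) (fun p => Some p)).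
    + apply total_computable_odds.
    + apply total_computable_id.
    + intros p x hx _. apply delta_BaireSp_eq in hx as ->. exists p, p. split; auto.
      split; [apply delta_BaireSp|]. split.
      * assert (hd : forall s, g0 p s -> dom f0 s).
        { intros s (x & -> & _). destruct (classic (closed_of p x)) as [h|h].
          - exists zeros. apply hK'. exact h.
          - apply NNPP in h as [j hj]. exists (fun _ => S j). apply hK'. exact hj. }
        assert (exists s, g0 p s) as [s hs].
        { destruct (classic (exists x, closed_of p x)) as [[x hx]|h].
          - exists (bpair p x), x. auto.
          - exists (bpair p zeros), zeros. split; auto. intro; contradiction. }
        destruct (hd s hs) as [q hq]. exists q. split; eauto.
      * intros q y hq (_ & s & (x & -> & hx) & hy). apply delta_BaireSp_eq in hq as ->.
        rewrite odds_bpair. exists q. split; auto. exists q. split; [apply delta_BaireSp|].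
        apply hK' in hy. unfold nonempty_test. destruct (q 0) as [|j].
        -- split; eauto.
        -- split; [discriminate|]. intros hn. elim (hx hn). eauto.
Qed.

(** * Separations *)

Definition open_rel (O : Baire -> Baire -> Prop) : Prop :=
  forall p x, O p x -> exists j, forall p' x', agree j p p' -> agree j x x' -> O p' x'.

(** Iterating from [zeros], the [k]-th iterate is final on its first [k] values, and the diagonal is
    the fixed point. *)
Lemma course_of_values_fixpoint (V : nat -> Baire -> nat) :
  (forall n p q, agree n p q -> V n p = V n q) -> exists p, forall n, p n = V n p.
Proof.
  intros hV. set (it := fun k => Nat.iter k (fun p n => V n p) zeros).
  assert (h1 : forall k, agree k (it k) (it (S k))).
  { induction k as [|k IH]; intros n hn; [lia|].
    change (V n (it k) = V n (it (S k))). apply hV. eapply agree_le; [|exact IH]. lia. }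
  assert (h2 : forall k l, k <= l -> agree k (it k) (it l)).
  { intros k l h. induction h as [|l h IH]; [intros i _; reflexivity|].
    eapply agree_trans; [exact IH|]. eapply agree_le; [exact h | apply h1]. }
  exists (fun n => it (S n) n). intros n. change (V n (it n) = V n (fun n => it (S n) n)).
  apply hV. intros i hi. symmetry. apply (h2 (S i) n); lia.
Qed.

(* A recursion theorem: listing a ball may be delayed until the part of [p] written so far
   guarantees that [O p] covers it. Index [1] is the ball of the empty word. *)
Lemma self_referential_name O m :
  open_rel O ->
  exists p, agree m p zeros /\ (forall i, p i <> 1) /\ forall x, closed_of p x <-> ~ O p x.
Proof.
  intros hO.
  set (T := fun n p c => c <> 0 /\ forall p' x, agree n p p' -> inB (S c) x -> O p' x).
  set (V := fun n p => if n <? m then 0 else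
    if excluded_middle_informative (T n p (n - m)) then S (n - m) else 0).
  destruct (course_of_values_fixpoint V) as [p hp].
  { intros n p q h. assert (T n p (n - m) <-> T n q (n - m)) as e.
    { split; intros [h0 h1]; split; auto; intros p' x hp hx; apply h1; auto;
        eapply agree_trans; eauto using agree_sym. }
    unfold V. destruct (n <? m); auto.
    destruct (excluded_middle_informative (T n p (n - m))), (excluded_middle_informative
      (T n q (n - m))); tauto. }
  exists p. split; [|split].
  - intros i hi. rewrite hp. unfold V. destruct (Nat.ltb_spec i m); [reflexivity | lia].
  - intros i. rewrite hp. unfold V. destruct (i <? m); [discriminate|].
    destruct (excluded_middle_informative _) as [[h _]|_]; congruence.
  - intros x. unfold closed_of. apply not_iff_compat. split.
    + intros [n hn]. rewrite hp in hn. unfold V in hn. destruct (n <? m); [elim hn|].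
      destruct (excluded_middle_informative _) as [[_ h]|_]; [|elim hn].
      apply (h p x); auto. intros i _; reflexivity.
    + intros h. destruct (hO p x h) as [j hj].
      (* Length [S j] gives [c > j], so [c] is not the code of the empty word and position [m + c]
         comes after the first [j] letters of [p]. *)
      destruct (prefix_code x (S j)) as [c [hc hx]].
      pose proof (length_word_le c).
      exists (m + c). rewrite hp. unfold V.
      destruct (Nat.ltb_spec (m + c) m); [lia|]. replace (m + c - m) with c by lia.
      destruct (excluded_middle_informative _) as [_|ht].
      * apply hx. intros i _; reflexivity.
      * elim ht. split; [lia|]. intros p' x' h1 h2. apply hj.
        -- eapply agree_le; [|exact h1]. lia.
        -- apply hx in h2. eapply agree_le; [|exact h2]. lia.
Qed.

(* Emptiness is not a Sigma-1-1 property of names, not even locally. *)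
Lemma no_projection_of_closed O m :
  open_rel O ->
  ~ (forall p, agree m p zeros -> (forall i, p i <> 1) ->
       (exists x, closed_of p x) <-> ~ exists x, ~ O p x).
Proof.
  intros hO h. destruct (self_referential_name O m hO) as (p & h1 & h2 & h3).
  specialize (h p h1 h2).
  assert ((exists x, closed_of p x) <-> exists x, ~ O p x)
    by (split; intros [x hx]; exists x; apply h3; auto).
  tauto.
Qed.

Lemma eval_bpair_use p x t args v :
  eval (bpair p x) t args v ->
  exists j, forall p' x', agree j p p' -> agree j x x' -> eval (bpair p' x') t args v.
Proof.
  intros h. destruct (eval_use _ _ _ _ h) as [j hj]. exists j. intros.
  apply hj, agree_bpair; auto.
Qed.

Definition tail (x : Baire) : Baire := fun i => x (S i).
Definition scons (j : nat) (y : Baire) : Baire :=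
  fun i => match i with 0 => j | S i => y i end.

Lemma agree_tail j x x' : agree (S j) x x' -> agree j (tail x) (tail x').
Proof. intros h i hi. apply h. lia. Qed.

Lemma open_rel_or O1 O2 : open_rel O1 -> open_rel O2 -> open_rel (fun p x => O1 p x \/ O2 p x).
Proof.
  intros h1 h2 p x [h|h]; [destruct (h1 p x h) as [j hj] | destruct (h2 p x h) as [j hj]];
    exists j; auto.
Qed.

Lemma open_rel_and O1 O2 :
  open_rel O1 -> open_rel O2 -> open_rel (fun p x => O1 p x /\ O2 p x).
Proof.
  intros h1 h2 p x [h h']. destruct (h1 p x h) as [j hj]. destruct (h2 p x h') as [k hk].
  exists (max j k). intros p' x' ha hb.
  split; [apply hj | apply hk]; (eapply agree_le; [|eassumption]; lia).
Qed.

(** Phrased by the term, so that it makes sense and is open also where the functional is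
    undefined. *)
Definition excluded_by (t : term) (p y : Baire) : Prop := exists n v, eval p t [n] v /\ inB v y.

Lemma excluded_by_iff t p k y :
  (forall n, eval p t [n] (k n)) -> excluded_by t p y <-> ~ closed_of k y.
Proof.
  intros hk. split.
  - intros (n & v & hv & hy) hc. apply hc. exists n. rewrite (eval_det _ _ _ _ (hk n) _ hv).
    exact hy.
  - intros h. apply NNPP in h as [n hn]. exists n, (k n). auto.
Qed.

Lemma open_excluded_by t : open_rel (fun p x => excluded_by t p (tail x)).
Proof.
  intros p x (n & v & hv & hy). destruct (eval_use _ _ _ _ hv) as [j hj].
  exists (max j (S v)). intros p' x' hp hx. exists n, v. split.
  - apply hj. eapply agree_le; [|exact hp]; lia.
  - eapply inB_agree; [exact hy|]. apply agree_tail. eapply agree_le; [|exact hx]; lia.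
Qed.

(* [x 0] bounds how much of [p] and [tail x] the property [Q] may inspect. *)
Definition locally_forced (Q : Baire -> Baire -> Prop) (p x : Baire) : Prop :=
  forall p' y', agree (x 0) p p' -> agree (x 0) (tail x) y' -> Q p' y'.

(** Whether [Q] is forced depends only on [x 0] and on prefixes of that length. Storing the modulus
    in the witness thus makes an open condition closed. *)
Lemma open_not_locally_forced Q : open_rel (fun p x => ~ locally_forced Q p x).
Proof.
  intros p x h. exists (S (x 0)). intros p' x' hp hx hf. apply h. intros p'' y'' h1 h2.
  assert (e : x 0 = x' 0) by (apply hx; lia). apply hf; rewrite <- e.
  - eapply agree_trans; [|exact h1]. apply agree_sym. eapply agree_le; [|exact hp]; lia.
  - eapply agree_trans; [|exact h2]. apply agree_sym, agree_tail, hx.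
Qed.

Lemma locally_forced_self Q p x : locally_forced Q p x -> Q p (tail x).
Proof. intros h. apply h; intros i _; reflexivity. Qed.

Lemma nonempty_test_nle_Tot_CB : ~ Wred nonempty_test (Tot CB).
Proof.
  intros hred. destruct (Wred_elim _ _ realizable_Tot_CB hred) as (H & K & [tH hH] & [tK hK] & hr).
  assert (step : forall p, exists k, (forall n, eval p tK [n] (k n)) /\
    forall q, ((exists x, closed_of k x) -> closed_of k q) ->
      exists v, eval (bpair p q) tH [0] v /\ (v = 0 <-> exists x, closed_of p x)).
  { intros p. destruct (hr p p (delta_BaireSp p)) as (k & hk & _ & ha).
    { destruct (classic (exists x, closed_of p x)) as [e|e].
      - exists zeros. split; auto.
      - exists (fun _ => 1). split; [discriminate | intro; contradiction]. }
    exists k. split; [apply hK, hk|]. intros q hq.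
    destruct (ha q (answers_Tot_CB _ _ hq)) as (r & hr' & y & hy & hn).
    apply delta_BaireSp_eq in hy as ->. exists (r 0). split; [apply (hH _ _ hr') | exact hn]. }
  (* [zeros] names the whole space, so the verdict there is [0]; its use [m] fixes the neighbourhood
     in which the diagonalization takes place. *)
  destruct (step zeros) as (k0 & _ & h0).
  assert (exists q0, (exists x, closed_of k0 x) -> closed_of k0 q0) as [q0 hq0].
  { destruct (classic (exists x, closed_of k0 x)) as [[x hx]|e]; [eauto|].
    exists zeros. intro; contradiction. }
  destruct (h0 q0 hq0) as (v0 & hv0 & hz).
  assert (v0 = 0) as ->. { apply hz. exists zeros. intros [n []]. }
  destruct (eval_bpair_use _ _ _ _ _ hv0) as [m hm].
  set (Q := fun p y => exists v, eval (bpair p y) tH [0] (S v)).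
  apply (no_projection_of_closed
    (* A witness against this relation is a point of the queried set on which the verdict is
       emptiness, with the use of that verdict in [x 0]. *)
    (fun p x => excluded_by tK p (tail x) \/ ~ locally_forced Q p x) m).
  { apply open_rel_or; [apply open_excluded_by | apply open_not_locally_forced]. }
  intros p hp _. destruct (step p) as (k & hk & ha).
  assert (hp' : agree m zeros p) by (apply agree_sym; exact hp). split.
  - intros hne [x hx]. apply not_or_and in hx as [hx1 hx2].
    rewrite (excluded_by_iff _ _ k) in hx1 by auto. apply NNPP in hx1. apply NNPP in hx2.
    destruct (locally_forced_self _ _ _ hx2) as [v hv].
    destruct (ha (tail x)) as (w & hw & e); [auto|].
    pose proof (eval_det _ _ _ _ hv _ hw). apply e in hne. lia.
  - intros hx. apply NNPP. intros hne. apply hx.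
    destruct (classic (exists y, closed_of k y)) as [[y hy]|he].
    + destruct (ha y) as ([|v] & hv & e); [auto| elim hne; apply e; reflexivity|].
      destruct (eval_bpair_use _ _ _ _ _ hv) as [j hj].
      exists (scons j y). apply and_not_or.
      change (tail (scons j y)) with y. rewrite (excluded_by_iff _ _ k) by auto.
      split; [tauto|]. intros hf. apply hf. intros p' y' h1 h2. exists v. apply hj; auto.
    (* An empty query admits [q0] as an answer, and near [zeros] this yields the verdict [0],
       contradicting the emptiness of the input. *)
    + destruct (ha q0) as (v & hv & e); [intro; contradiction|].
      elim hne. apply e. eapply eval_det; [exact hv|]. apply hm; auto. intros i _; reflexivity.
Qed.

Lemma cnt_agree i p q : agree i p q -> cnt p i = cnt q i.
Proof.
  induction i as [|i IH]; intros h; simpl; auto.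
  rewrite IH by (eapply agree_le; [|exact h]; lia). rewrite (h i) by lia. reflexivity.
Qed.

Lemma minus1_infinite z : (forall j, exists i, j <= i /\ z i <> 0) -> exists x, minus1 z x.
Proof.
  intros h.
  assert (next : forall d j, z (j + d) <> 0 -> exists i, z i <> 0 /\ cnt z i = cnt z j).
  { induction d as [|d IH]; intros j hj.
    - exists j. rewrite Nat.add_0_r in hj. auto.
    - destruct (Nat.eq_dec (z j) 0) as [e|e]; [|eauto].
      destruct (IH (S j)) as (i & hi & hc).
      + replace (S j + d) with (j + S d) by lia. exact hj.
      + exists i. split; auto. rewrite hc. simpl. rewrite e. simpl. lia. }
  assert (next' : forall j, exists i, z i <> 0 /\ cnt z i = cnt z j).
  { intros j. destruct (h j) as (i & hi & hz). apply (next (i - j)).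
    replace (j + (i - j)) with i by lia. exact hz. }
  assert (all : forall k, exists i, z i <> 0 /\ cnt z i = k).
  { induction k as [|k (i & hi & hk)]; [apply (next' 0)|].
    destruct (next' (S i)) as (i' & hi' & hc). exists i'. split; auto. rewrite hc. simpl.
    destruct (Nat.eqb_spec (z i) 0); lia. }
  destruct (choice (fun k v => exists i, z i <> 0 /\ cnt z i = k /\ v = z i - 1)) as [x hx].
  - intros k. destruct (all k) as (i & hi & hk). eauto.
  - exists x. exact hx.
Qed.

(* Solving nonempty instances correctly while always producing some output makes emptiness a
   projection of a closed relation: [p] names the empty set iff some [y] in the set named by
   [K p] leads to an output that is finite or provably not in the set named by [p]. *)
Lemma no_total_extension_of_CB :
  ~ exists H K, computable H /\ computable K /\
    forall p, (forall i, p i <> 1) -> exists k, K p = Some k /\ (exists y, closed_of k y) /\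
      forall y, closed_of k y -> exists z, H (bpair p y) = Some z /\
        ((exists x, closed_of p x) -> exists x, minus1 z x /\ closed_of p x).
Proof.
  intros (H & K & [tH hH] & [tK hK] & hs).
  (* A finite part of the output already places every continuation inside a ball listed by [p]. *)
  set (E := fun p y => exists N z n, (forall i, i < N -> eval (bpair p y) tH [i] (z i)) /\
    forall x, (forall i, i < N -> z i <> 0 -> x (cnt z i) = z i - 1) -> inB (p n) x).
  assert (openE : open_rel E).
  { intros p y (N & z & n & hz & hn).
    destruct (bounded_max (fun i j => forall p' y', agree j p p' -> agree j y y' ->
      eval (bpair p' y') tH [i] (z i))) with (n := N) as [j hj].
    - intros i j k hjk h p' y' h1 h2. apply h; eapply agree_le; eauto.
    - intros i hi. apply eval_bpair_use. auto.
    - exists (max j (S n)). intros p' y' h1 h2. exists N, z, n. split.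
      + intros i hi. apply hj; auto; (eapply agree_le; [|eassumption]; lia).
      + rewrite <- (h1 n) by lia. exact hn. }
  (* The negation says that nothing is output from position [x 0] on, hence that the output is
     finite. *)
  set (F := fun p x => exists i v, x 0 <= i /\ eval (bpair p (tail x)) tH [i] (S v)).
  assert (openF : open_rel F).
  { intros p x (i & v & hi & hv). destruct (eval_bpair_use _ _ _ _ _ hv) as [j hj].
    exists (S j). intros p' x' h1 h2. exists i, v. split; [rewrite <- (h2 0); [auto|lia]|].
    apply hj; [eapply agree_le; [|exact h1]; lia | apply agree_tail, h2]. }
  apply (no_projection_of_closed
    (fun p x => excluded_by tK p (tail x) \/ (F p x /\ ~ locally_forced E p x)) 0).
  { apply open_rel_or; [apply open_excluded_by|].
    apply open_rel_and; [exact openF | apply open_not_locally_forced]. }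
  intros p _ hp. destruct (hs p hp) as (k & hk & [y0 hy0] & ha). split.
  - intros hne [x hx]. apply not_or_and in hx as [hx1 hx2].
    rewrite (excluded_by_iff _ _ k) in hx1 by (apply hK, hk). apply NNPP in hx1.
    destruct (ha (tail x) hx1) as (z & hz & hm). destruct (hm hne) as (w & hw & hc).
    pose proof (hH _ _ hz) as ez. apply not_and_or in hx2 as [hx2|hx2].
    (* The letter with this number cannot stand before position [x 0], since only smaller numbers
       occur there. *)
    + destruct (hw (cnt z (x 0))) as (i & hi & hci & _). apply hx2.
      destruct (le_lt_dec (x 0) i) as [hle|hlt].
      * exists i, (pred (z i)). split; auto. replace (S (pred (z i))) with (z i) by lia. auto.
      * apply (cnt_le z (S i) (x 0)) in hlt. simpl in hlt.
        destruct (Nat.eqb_spec (z i) 0); lia.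
    + apply NNPP in hx2.
      destruct (locally_forced_self _ _ _ hx2) as (N & z' & n & hz' & hn).
      apply hc. exists n. apply hn.
      assert (hzz : agree N z z') by (intros i hi; eapply eval_det; eauto).
      intros i hi h0. rewrite <- (cnt_agree i z z'), <- (hzz i hi).
      * apply minus1_nth; auto. rewrite (hzz i hi); auto.
      * eapply agree_le; [|exact hzz]. lia.
  - intros hx. apply NNPP. intros hne. apply hx.
    destruct (ha y0 hy0) as (z & hz & _). pose proof (hH _ _ hz) as ez.
    destruct (classic (exists w, minus1 z w)) as [[w hw]|hfin].
    + assert (E p y0) as hE.
      { assert (~ closed_of p w) as hc by (intro; apply hne; eauto).
        apply NNPP in hc as [n hn].
        (* The ball inspects at most [p n] letters of [w]; [N] is chosen so that all of them have
           been output. *)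
        destruct (bounded_max (fun l N => exists i, i < N /\ z i <> 0 /\ cnt z i = l /\
          w l = z i - 1)) with (n := p n) as [N hN].
        - intros l i i' hii (a & h1 & h2). exists a. split; [lia | exact h2].
        - intros l _. destruct (hw l) as (i & h1 & h2 & h3). exists (S i), i. auto.
        - exists N, z, n. split; [auto|]. intros x' hx'. eapply inB_agree; [exact hn|].
          intros l hl. destruct (hN l hl) as (i & h1 & h2 & <- & ->).
          symmetry. auto. }
      destruct (openE p y0 hE) as [j hj]. exists (scons j y0). apply and_not_or.
      change (tail (scons j y0)) with y0.
      rewrite (excluded_by_iff _ _ k) by (apply hK, hk). split; [tauto|].
      intros [_ h]. apply h. exact hj.
    + assert (exists j, forall i, j <= i -> z i = 0) as [j hj].
      { apply NNPP. intros h. apply hfin, minus1_infinite. intros j. apply NNPP. intros h'.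
        apply h. exists j. intros i hi. apply NNPP. intros hz0. apply h'. eauto. }
      exists (scons j y0). apply and_not_or.
      change (tail (scons j y0)) with y0.
      rewrite (excluded_by_iff _ _ k) by (apply hK, hk). split; [tauto|].
      intros [(i & v & hi & hv) _]. change (tail (scons j y0)) with y0 in hv.
      specialize (hj i hi). pose proof (eval_det _ _ _ _ hv _ (ez i)). lia.
Qed.

(** [pbar CB] is defined on empty sets too, so the reduction must send every name to a nonempty
    query, which [no_total_extension_of_CB] excludes. *)
Lemma pbar_CB_nle_CB : ~ Wred (pbar CB) CB.
Proof.
  intros hred. destruct (Wred_elim _ _ realizable_CB hred) as (H & K & cH & cK & hr).
  apply no_total_extension_of_CB.
  exists (fun v => obind (Some (bpair (succ_seq (evens v)) (odds v))) H),
    (fun p => obind (Some (succ_seq p)) K). split; [|split].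
  - apply (computable_comp H (fun v => Some (bpair (succ_seq (evens v)) (odds v)))); auto.
    apply total_computable_bpair; [|apply total_computable_odds].
    apply total_computable_comp; auto using total_computable_succ, total_computable_evens.
  - apply (computable_comp K (fun p => Some (succ_seq p))); auto. apply total_computable_succ.
  - intros p _. destruct (hr (succ_seq p) (Some (closed_of p))) as (k & hk & hne & ha).
    { exists p. auto using minus1_succ, delta_closed_of. }
    { apply dom_pbar. }
    exists k. split; auto. split.
    { destruct hne as (A & hA & x & hx). exists x. apply hA, hx. }
    intros y hy. destruct (ha y (answers_CB _ _ hy)) as (z & hz & oy & hoy & hb).
    exists z. simpl. rewrite evens_bpair, odds_bpair. split; auto.
    intros hx. destruct (hb hx) as (w & -> & hw'). destruct hoy as (w' & hm & hd).
    apply delta_BaireSp_eq in hd as ->. eauto.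
Qed.

(** A sequence starting with [d] avoids every ball of a nonempty word listed so far, and [d] differs
    from the letter [v] already output. *)
Lemma first_letters_bounded (p : Baire) j v : exists d, v < d /\
  forall i, i < j -> match p i with S c => hd 0 (word c) < d | 0 => True end.
Proof.
  induction j as [|j (d & hvd & h)].
  - exists (S v). split; [lia|]. intros i hi. lia.
  - exists (d + match p j with S c => S (hd 0 (word c)) | 0 => 0 end). split; [lia|].
    intros i hi. destruct (Nat.eq_dec i j) as [->|hne].
    + destruct (p j); [auto | lia].
    + specialize (h i ltac:(lia)). destruct (p i); [auto | lia].
Qed.

Lemma Tot_CB_nle_pbar_CB : ~ Wred (Tot CB) (pbar CB).
Proof.
  intros hred. destruct (Wred_elim _ _ realizable_pbar_CB hred) as (H & K & cH & cK & hr).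
  assert (step : forall p, exists k, K p = Some k /\ forall q,
    (forall k', minus1 k k' -> (exists x, closed_of k' x) ->
       exists x, minus1 q x /\ closed_of k' x) ->
    exists z, H (bpair p q) = Some z /\ ((exists x, closed_of p x) -> closed_of p z)).
  { intros p. destruct (hr p (closed_of p) (delta_closed_of p)) as (k & hk & _ & ha).
    { exact (dom_Tot CB zeros _). }
    exists k. split; auto. intros q hq.
    destruct (ha q (answers_pbar_CB _ _ hq)) as (z & hz & y & hy & ht).
    apply delta_BaireSp_eq in hy as ->. eauto. }
  (* [zeros] is a name of bottom that can still become a name of anything; if it were
     acceptable, the first output letter would be fixed too early. *)
  assert (defined : forall p, (forall i, p i <> 1) -> forall k, K p = Some k ->
    exists k', minus1 k k' /\ exists x, closed_of k' x).
  { intros p hp k hk. apply NNPP. intros hno.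
    destruct (step p) as (k0 & hk0 & ha). replace k0 with k in ha by congruence.
    destruct (ha zeros) as (z & hz & _).
    { intros k' h1 h2. elim hno. eauto. }
    destruct cH as [tH hH]. pose proof (hH _ _ hz 0) as hz0.
    destruct (eval_bpair_use _ _ _ _ _ hz0) as [j hj].
    destruct (first_letters_bounded p j (z 0)) as (d & hd & hlet).
    destruct (choice (fun e c => word c = [e])) as [code hcode]; [intros; apply word_surj|].
    (* From position [j] on, every first letter other than [d] is excluded. *)
    set (p' := fun i => if i <? j then p i else
      if i - j =? d then 0 else S (code (i - j))).
    assert (hpp : agree j p p').
    { intros i hi. unfold p'. destruct (Nat.ltb_spec i j); [reflexivity | lia]. }
    assert (hne : exists x, closed_of p' x).
    { exists (fun _ => d). intros [n hn]. unfold p' in hn.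
      destruct (Nat.ltb_spec n j) as [hlt|_].
      - specialize (hlet n hlt). specialize (hp n). destruct (p n) as [|c]; [exact hn|].
        destruct c as [|c]; [congruence|]. specialize (hn 0). rewrite word_S in *.
        simpl in hn, hlet. specialize (hn ltac:(lia)). lia.
      - destruct (Nat.eqb_spec (n - j) d) as [_|hne]; [exact hn|].
        specialize (hn 0). rewrite hcode in hn. specialize (hn ltac:(simpl; lia)).
        simpl in hn. congruence. }
    assert (hfirst : forall x, closed_of p' x -> x 0 = d).
    { intros x hx. apply NNPP. intros hxd. apply hx. exists (j + x 0). unfold p'.
      destruct (Nat.ltb_spec (j + x 0) j); [lia|]. replace (j + x 0 - j) with (x 0) by lia.
      destruct (Nat.eqb_spec (x 0) d); [contradiction|].
      intros i hi. rewrite hcode in *. simpl in hi. replace i with 0 by lia. reflexivity. }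
    destruct (step p') as (k' & hk' & ha').
    (* Some correct answer for [p'] starts with [j] zeros, so the computation of the first letter
       cannot tell it from [zeros]. *)
    assert (exists r, agree j zeros r /\ forall k'', minus1 k' k'' ->
      (exists x, closed_of k'' x) -> exists x, minus1 r x /\ closed_of k'' x) as (r & hr0 & hrr).
    { destruct (classic (exists k'' x, minus1 k' k'' /\ closed_of k'' x)) as
        [(k'' & x & h1 & h2)|h].
      - exists (fun i => if i <? j then 0 else S (x (i - j))). split.
        + intros i hi. destruct (Nat.ltb_spec i j); [reflexivity | lia].
        + intros k3 h3 _. rewrite (minus1_unique _ _ _ h3 h1). eauto using minus1_shift.
      - exists zeros. split; [intros i _; reflexivity|]. intros k'' h1 [x h2]. elim h; eauto. }
    destruct (ha' r hrr) as (z' & hz' & hc).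
    assert (z 0 = z' 0).
    { eapply eval_det; [apply hj; [exact hpp | exact hr0] | apply (hH _ _ hz')]. }
    pose proof (hfirst z' (hc hne)). lia. }
  apply no_total_extension_of_CB.
  (* As all queries are nonempty closed sets, the reduction becomes one to [CB] itself, with
     [pred_seq] removing the padding. *)
  exists (fun v => obind (obind (Some (bpair (evens v) (succ_seq (odds v)))) H)
    (fun z => Some (succ_seq z))),
    (fun p => obind (K p) (fun k => Some (pred_seq k))). split; [|split].
  - apply (computable_comp (fun z => Some (succ_seq z))
      (fun v => obind (Some (bpair (evens v) (succ_seq (odds v)))) H));
      [apply total_computable_succ|].
    apply (computable_comp H (fun v => Some (bpair (evens v) (succ_seq (odds v))))); auto.
    apply total_computable_bpair; [apply total_computable_evens|].
    apply total_computable_comp; auto using total_computable_succ, total_computable_odds.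
  - apply (computable_comp (fun k => Some (pred_seq k)) K); auto. apply total_computable_pred.
  - intros p hp. destruct (step p) as (k & hk & ha).
    destruct (defined p hp k hk) as (k' & hm & x & hx).
    exists (pred_seq k). rewrite hk. split; auto. split.
    { exists x. apply (closed_of_pred _ _ _ hm), hx. }
    intros y hy. destruct (ha (succ_seq y)) as (z & hz & hc).
    { intros k2 h2 _. exists y. split; [apply minus1_succ|].
      apply (closed_of_pred _ _ _ h2), hy. }
    exists (succ_seq z). simpl. rewrite evens_bpair, odds_bpair, hz. split; auto.
    intros hne. exists z. auto using minus1_succ.
Qed.

Theorem theorem11p6 :
  Wlt CB (pbar CB) /\ Wlt (pbar CB) (Tot CB) /\
  forall (X1 Y1 X2 Y2 : RepSp) (h1 : problem X1 Y1) (h2 : problem X2 Y2),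
    IsCompProd CB (pbar CB) h1 -> IsCompProd CB (Tot CB) h2 ->
    Wlt (Tot CB) h1 /\ Wequiv h1 h2.
Proof.
  split; [split; [apply CB_le_pbar_CB | apply pbar_CB_nle_CB]|].
  split; [split; [apply pbar_CB_le_Tot_CB | apply Tot_CB_nle_pbar_CB]|].
  intros X1 Y1 X2 Y2 h1 h2 [up1 ex1] [up2 ex2].
  assert (h12 : Wred h1 h2).
  { destruct ex1 as (X & Y & Z & f0 & g0 & hf & hg & h).
    apply (Wred_trans _ _ _ h). apply up2; auto.
    apply (Wred_trans _ _ _ hg), pbar_CB_le_Tot_CB. }
  assert (h21 : Wred h2 h1).
  { destruct ex2 as (X & Y & Z & f0 & g0 & hf & hg & h).
    destruct (comp_Tot_CB_le_comp_pbar_CB f0 g0 hf hg) as (f1 & g1 & hf1 & hg1 & h').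
    apply (Wred_trans _ _ _ h), (Wred_trans _ _ _ h'). apply up1; auto. }
  assert (refl_Tot : Wred (Tot CB) (Tot CB)).
  { exists (fun v => Some (odds v)), (fun p => Some p). split; [|split].
    - apply total_computable_odds.
    - apply total_computable_id.
    - intros G hG p x hx hd. destruct (hG p x hx hd) as (q & hq & hy).
      exists q. simpl. rewrite hq. simpl. rewrite odds_bpair. auto. }
  split; [split|split; assumption].
  - destruct Tot_CB_le_comp as (f0 & hf0 & h).
    apply (Wred_trans _ _ _ h). refine (Wred_trans _ _ _ _ h21). apply up2; auto.
  (* The test for nonemptiness lies below the product, so a reduction back would put it below
     [Tot CB]. *)
  - intros hle. destruct nonempty_test_le_comp as (f0 & g0 & hf0 & hg0 & h).
    apply nonempty_test_nle_Tot_CB. apply (Wred_trans _ _ _ h).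
    refine (Wred_trans _ _ _ _ hle). refine (Wred_trans _ _ _ _ h21). apply up2; auto.
Qed.
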